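(* Let $m\ge n\ge 1$, let $X\in\mathbb{R}^{m\times n}$ have full column rank, let $\eta>0$, and put $j=\|X\|_F/\|X\|_2$. Let $[Q,R]=\mathrm{CholeskyQR2}(X)$ be the factors computed in floating-point arithmetic, where the rounding errors in the first product $X^\top X$ follow the randomized model and all other steps follow the deterministic model (both described in the context). Assume $$\max(\eta\sqrt{m}\,n\mathbf{u},\,mn\mathbf{u})\le\tfrac1{64},\qquad n(n+1)\mathbf{u}\le\tfrac1{64},$$ $$\delta_1:=8j\,\kappa_2(X)\sqrt{\eta\sqrt{m}\,\mathbf{u}+(n+1)\mathbf{u}}\le 1 .$$ Then, with probability at least $Q(\eta,mn^2)$, $$\|Q^\top Q-I\|_F\le 6\,(mn\mathbf{u}+n(n+1)\mathbf{u}),$$ $$\|QR-X\|_F\le (2.30\,j+1.21\sqrt n)\cdot n\sqrt n\,\mathbf{u}\,\|X\|_2 .$$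
   Context: Notation: $\|\cdot\|_F$ and $\|\cdot\|_2$ are the Frobenius and spectral norms, $\sigma_{\min}(X)$ is the smallest singular value, $\kappa_2(X)=\|X\|_2/\sigma_{\min}(X)$, $\mathbf{u}=2^{-53}$ is the unit roundoff, $|A|$ is the entrywise absolute value of a matrix $A$, and matrix inequalities between absolute values are entrywise. Algorithms. CholeskyQR$(A)$, for $A\in\mathbb{R}^{m\times n}$: compute $G=A^\top A$; compute the upper-triangular Cholesky factor $T$ of $G$; compute $V=AT^{-1}$; output $[V,T]$. CholeskyQR2$(X)$: $[W,Y]=$ CholeskyQR$(X)$; $[Q,Z]=$ CholeskyQR$(W)$; compute $R=ZY$; output $[Q,R]$. All these symbols denote the computed (rounded) matrices. Deterministic model (all steps other than the first product $X^\top X$): each operation satisfies $fl(a\ \mathrm{op}\ b)=(a\ \mathrm{op}\ b)(1+\delta)$, $|\delta|\le\mathbf{u}$. With $\gamma_k=\frac{k\mathbf{u}}{1-k\mathbf{u}}$, a computed product of matrices with inner dimension $k$ satisfies $|AB-fl(AB)|\le\gamma_k|A||B|$; a computed Cholesky factor $T$ of an $n\times n$ matrix $G$ satisfies $T^\top T=G+\Delta$ with $|\Delta|\le\gamma_{n+1}|T^\top||T|$; the computed $V=AT^{-1}$ with $T$ an $n\times n$ upper-triangular matrix satisfies $|VT-A|\le\gamma_n|V||T|$. Randomized model (assumed for the first step $G=fl(X^\top X)$): the rounding errors $\delta_1,\delta_2,\dots$ generated in that order are random variables with $|\delta_k|\le\mathbf u$ and $\mathbb{E}(\delta_k\mid\delta_1,\dots,\delta_{k-1})=\mathbb{E}(\delta_k)=0$;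 accordingly, with probability at least $Q(\eta,mn^2)$, $|G-X^\top X|\le\tilde\gamma_m(\eta)\,|X^\top||X|$. Here $$\tilde\gamma_k(\eta)=\exp\Big(\eta\sqrt k\,\mathbf{u}+\frac{k\mathbf{u}^2}{1-\mathbf{u}}\Big)-1,\quad P(\eta)=1-2\exp\Big(-\frac{\eta^2(1-\mathbf{u})^2}{2}\Big),\quad Q(\eta,N)=1-N(1-P(\eta)).$$ The scalar function $Q(\eta,N)$ is unrelated to the matrix $Q$. *)

(* Defs.v *)
From HB Require Import structures.
From mathcomp Require Import all_boot all_order all_algebra.
From mathcomp Require Import all_classical all_reals all_analysis.

Set Implicit Arguments.
Unset Strict Implicit.
Unset Printing Implicit Defensive.

Import Order.TTheory GRing.Theory Num.Theory.

Local Open Scope classical_set_scope.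
Local Open Scope ring_scope.

Definition absmx (R : numDomainType) m n (A : 'M[R]_(m, n)) : 'M[R]_(m, n) :=
  map_mx (fun x => `|x|) A.

Definition lemx (R : numDomainType) m n (A B : 'M[R]_(m, n)) : Prop :=
  forall i j, A i j <= B i j.

Definition normF (R : rcfType) m n (A : 'M[R]_(m, n)) : R :=
  Num.sqrt (\sum_(i < m) \sum_(j < n) A i j ^+ 2).

(* The norm induced by the Euclidean norm (on column vectors, [normF] is the
   Euclidean norm); meaningful for n > 0, where the unit sphere is nonempty. *)
Definition norm2 (R : realType) m n (A : 'M[R]_(m, n)) : R :=
  sup [set normF (A *m v) | v in [set v : 'cV[R]_n | normF v = 1]].

Definition singular_value (R : realType) m n (A : 'M[R]_(m, n)) (s : R) : Prop :=
  0 <= s /\ eigenvalue (A^T *m A) (s ^+ 2).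

(* For m >= n > 0, this is the least of the n singular values of A. *)
Definition sigma_min (R : realType) m n (A : 'M[R]_(m, n)) : R :=
  inf [set s | singular_value A s].

Definition kappa2 (R : realType) m n (A : 'M[R]_(m, n)) : R :=
  norm2 A / sigma_min A.

Definition uroundoff (R : realType) : R := 2 ^- 53.
Arguments uroundoff {R}.

Definition gamma (R : realType) (k : nat) : R :=
  k%:R * uroundoff / (1 - k%:R * uroundoff).
Arguments gamma {R} k.

Definition Pprob (R : realType) (eta : R) : R :=
  1 - 2 * expR (- (eta ^+ 2 * (1 - uroundoff) ^+ 2 / 2)).

Definition Qprob (R : realType) (eta : R) (N : nat) : R :=
  1 - N%:R * (1 - Pprob eta).

(* Deterministic model. Each predicate relates exact inputs to every matrix
   that the model admits as the computed result. *)
Definition fl_mulmx (R : realType) m k n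
    (A : 'M[R]_(m, k)) (B : 'M[R]_(k, n)) (C : 'M[R]_(m, n)) : Prop :=
  lemx (absmx (A *m B - C)) (gamma k *: (absmx A *m absmx B)).

(* [is_trig_mx] means lower triangular. *)
Definition upper_triangular (R : realType) n (T : 'M[R]_n) : Prop :=
  is_trig_mx T^T.

Definition fl_cholesky (R : realType) n (G T : 'M[R]_n) : Prop :=
  [/\ upper_triangular T,
      forall i, 0 < T i i &
      lemx (absmx (T^T *m T - G)) (gamma n.+1 *: (absmx T^T *m absmx T))].

(* V is a computed A T^-1 *)
Definition fl_trsolve (R : realType) m n
    (A : 'M[R]_(m, n)) (T : 'M[R]_n) (V : 'M[R]_(m, n)) : Prop :=
  lemx (absmx (V *m T - A)) (gamma n *: (absmx V *m absmx T)).

(* CholeskyQR once the computed Gram matrix G of A is known; output [V, T] *)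
Definition fl_choleskyqr_from (R : realType) m n (G : 'M[R]_n)
    (A V : 'M[R]_(m, n)) (T : 'M[R]_n) : Prop :=
  fl_cholesky G T /\ fl_trsolve A T V.

Definition fl_choleskyqr (R : realType) m n
    (A V : 'M[R]_(m, n)) (T : 'M[R]_n) : Prop :=
  exists G : 'M[R]_n, fl_mulmx A^T A G /\ fl_choleskyqr_from G A V T.

(* CholeskyQR2 once the computed first product G of X^T and X is known;
   output [Q, S] *)
Definition fl_choleskyqr2_from (R : realType) m n (G : 'M[R]_n)
    (X Q : 'M[R]_(m, n)) (S : 'M[R]_n) : Prop :=
  exists (W : 'M[R]_(m, n)) (Y Z : 'M[R]_n),
    [/\ fl_choleskyqr_from G X W Y,
        fl_choleskyqr W Q Z &
        fl_mulmx Z Y S].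

(* An order of evaluation of an inner product of length m: one multiplication
   per index, the products being added along an arbitrary binary tree. The
   natural number at each operation is the position, in the sequence of all
   rounding errors, of the error committed by that operation. *)
Inductive dot_tree (m : nat) : Type :=
| DotMul of nat & 'I_m
| DotAdd of nat & dot_tree m & dot_tree m.

Fixpoint dot_indices m (e : dot_tree m) : seq 'I_m :=
  match e with
  | DotMul _ i => [:: i]
  | DotAdd _ l r => dot_indices l ++ dot_indices r
  end.

Fixpoint dot_positions m (e : dot_tree m) : seq nat :=
  match e with
  | DotMul t _ => [:: t]
  | DotAdd t l r => t :: dot_positions l ++ dot_positions r
  end.

(* An addition is executed after the operations producing its operands. *)
Fixpoint dot_chronological m (e : dot_tree m) : bool :=
  match e with
  | DotMul _ _ => true
  | DotAdd t l r =>
      [&& all (fun s => (s < t)%N) (dot_positions l ++ dot_positions r),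
          dot_chronological l & dot_chronological r]
  end.

Definition dot_order m (e : dot_tree m) : Prop :=
  [/\ perm_eq (dot_indices e) (enum 'I_m),
      uniq (dot_positions e) &
      dot_chronological e].

(* The value computed when the errors are delta 0, delta 1, ... *)
Fixpoint fl_dot (R : realType) m (delta : nat -> R) (x y : 'I_m -> R)
    (e : dot_tree m) : R :=
  match e with
  | DotMul t i => x i * y i * (1 + delta t)
  | DotAdd t l r =>
      (fl_dot delta x y l + fl_dot delta x y r) * (1 + delta t)
  end.

Section Probability.
Context {d : measure_display} {Om : measurableType d} {R : realType}.
Variable P : probability Om R.

(* Y is a version of the conditional expectation of X given the
   sub-sigma-algebra F. *)
Definition is_cond_expectation (F : set (set Om)) (X Y : Om -> R) : Prop :=
  [/\ forall B : set R, measurable B -> F (Y @^-1` B),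
      P.-integrable setT (EFin \o Y) &
      forall A, F A ->
        (\int[P]_(w in A) (Y w)%:E = \int[P]_(w in A) (X w)%:E)%E].

(* Positions start at 0, so that the past of delta k is
   delta 0, ..., delta (k - 1). *)
Definition random_rounding_errors (delta : nat -> {RV P >-> R}) : Prop :=
  forall k : nat,
    [/\ forall w, `|delta k w| <= uroundoff,
        is_cond_expectation
          (g_sigma_preimage (fun i : 'I_k => delta i : Om -> R))
          (delta k) (cst 0) &
        ('E_P[delta k] = 0)%E].

(* G is the random matrix computed as the product of X^T and X with the
   rounding errors delta. Entries (a, b) and (b, a) may be computed
   separately or share their operations. *)
Definition fl_gram_random m n (delta : nat -> {RV P >-> R})
    (X : 'M[R]_(m, n)) (G : Om -> 'M[R]_n) : Prop :=
  exists e : 'I_n -> 'I_n -> dot_tree m,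
    (forall a b, dot_order (e a b)) /\
    (forall w a b, G w a b =
       fl_dot (fun k => delta k w) (fun i => X^T a i) (fun i => X i b) (e a b)).

(* Inner probability, so that E itself need not be shown measurable. *)
Definition with_probability_at_least (p : R) (E : set Om) : Prop :=
  exists A : set Om, [/\ measurable A, A `<=` E & (p%:E <= P A)%E].

End Probability.

(* Main.v *)
(* Each summand of a computed entry of the Gram matrix X^T X carries the product
   of (1 + delta_t) over the operations t on the path from its leaf to the root.
   These operations are executed in increasing order of t, so the sum of the
   delta_t along a path is a martingale with increments bounded by u; the
   Azuma-Hoeffding argument bounds it by eta sqrt(m) u except with probability
   2 exp(- eta^2 / 2), and a union bound over the m n^2 leaves controls all
   entries at once.

   On that event, a Cholesky factor Y of the computed Gram matrix satisfies
   Y^T Y = X^T X + E with |E|_F a small multiple of sigma_min(X)^2, by the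
   condition delta_1 <= 1. Hence |Y v| and |X v| are comparable, X Y^-1 is nearly
   orthonormal, and so is the computed W, which differs from X Y^-1 by a small
   matrix: |W^T W - I|_F <= 1/18. The same argument applied to the now well
   conditioned W gives |Q^T Q - I|_F of order m n u + n (n + 1) u. Finally
   Q R - X = Q (R - Z Y) + (Q Z - W) Y + (W Y - X), where each bracket is a
   backward error of the model. *)

Require Import Defs.
From HB Require Import structures.
From mathcomp Require Import all_boot all_order all_algebra.
From mathcomp Require Import all_classical all_reals all_analysis.
From mathcomp Require Import measurable_realfun.
From mathcomp Require Import ring lra.

Set Implicit Arguments.
Unset Strict Implicit.
Unset Printing Implicit Defensive.

Import Order.TTheory GRing.Theory Num.Theory.

Local Open Scope classical_set_scope.
Local Open Scope ring_scope.

(** * Frobenius norm and operator bounds *)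

Definition frob (R : pzRingType) m n (A B : 'M[R]_(m, n)) : R := \tr (A^T *m B).

Section FrobeniusProduct.
Variable R : realType.

Lemma frobE m n (A B : 'M[R]_(m, n)) :
  frob A B = \sum_i \sum_j A i j * B i j.
Proof.
rewrite /frob /mxtrace exchange_big; apply: eq_bigr => j _.
by rewrite !mxE; apply: eq_bigr => i _; rewrite !mxE.
Qed.

Lemma frobC m n (A B : 'M[R]_(m, n)) : frob A B = frob B A.
Proof. by rewrite /frob -mxtrace_tr trmx_mul trmxK. Qed.

Lemma frobDl m n (A B C : 'M[R]_(m, n)) : frob (A + B) C = frob A C + frob B C.
Proof. by rewrite /frob linearD mulmxDl mxtraceD. Qed.

Lemma frobZl m n a (A B : 'M[R]_(m, n)) : frob (a *: A) B = a * frob A B.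
Proof. by rewrite /frob linearZ -scalemxAl mxtraceZ. Qed.

Lemma frobDr m n (A B C : 'M[R]_(m, n)) : frob A (B + C) = frob A B + frob A C.
Proof. by rewrite frobC frobDl !(frobC A). Qed.

Lemma frobZr m n a (A B : 'M[R]_(m, n)) : frob A (a *: B) = a * frob A B.
Proof. by rewrite frobC frobZl frobC. Qed.

Lemma frob_mull m k n (A : 'M[R]_(m, k)) B (C : 'M[R]_(m, n)) :
  frob (A *m B) C = frob B (A^T *m C).
Proof. by rewrite /frob trmx_mul mulmxA. Qed.

Lemma normF_ge0 m n (A : 'M[R]_(m, n)) : 0 <= normF A.
Proof. exact: sqrtr_ge0. Qed.

Lemma normF_sqr m n (A : 'M[R]_(m, n)) : normF A ^+ 2 = frob A A.
Proof.
rewrite /normF sqr_sqrtr ?frobE//.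
by do 2!apply: sumr_ge0 => ? _; exact: sqr_ge0.
Qed.

Lemma normF_leP m n (A : 'M[R]_(m, n)) c :
  0 <= c -> (normF A <= c) = (frob A A <= c ^+ 2).
Proof. by move=> c0; rewrite -normF_sqr ler_sqr ?nnegrE ?normF_ge0. Qed.

Lemma normF_eq0 m n (A : 'M[R]_(m, n)) : (normF A == 0) = (A == 0).
Proof.
apply/idP/eqP => [|->]; last by rewrite -sqrf_eq0 normF_sqr /frob mulmx0 mxtrace0.
rewrite -sqrf_eq0 normF_sqr frobE psumr_eq0 => [/allP A0|i _]; last first.
  by apply: sumr_ge0 => j _; exact: sqr_ge0.
apply/matrixP => i j; have := A0 i; rewrite mem_index_enum /= => /(_ isT).
rewrite psumr_eq0 => [/allP/(_ j)|k _]; last exact: sqr_ge0.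
by rewrite mem_index_enum /= -expr2 sqrf_eq0 mxE => /(_ isT)/eqP.
Qed.

Lemma normF_gt0 m n (A : 'M[R]_(m, n)) : (0 < normF A) = (A != 0).
Proof. by rewrite lt_neqAle normF_ge0 andbT eq_sym normF_eq0. Qed.

(* Expanding the squared norm of [b *: A - c *: B], with [b := frob B B] and
   [c := frob A B], gives [b * (frob A A * b - c ^+ 2) >= 0]. *)
Lemma frob_CauchySchwarz m n (A B : 'M[R]_(m, n)) :
  frob A B ^+ 2 <= frob A A * frob B B.
Proof.
have [->|B0] := eqVneq B 0.
  by rewrite /frob !mulmx0 mxtrace0 mulr0 expr0n.
have b0 : 0 < frob B B by rewrite -normF_sqr exprn_gt0// normF_gt0.
rewrite -subr_ge0 -(pmulr_rge0 _ b0).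
suff <- : normF (frob B B *: A + (- frob A B) *: B) ^+ 2 =
    frob B B * (frob A A * frob B B - frob A B ^+ 2) by exact: sqr_ge0.
rewrite normF_sqr !(frobDl, frobDr, frobZl, frobZr) (frobC B A); ring.
Qed.

Lemma frob_le m n (A B : 'M[R]_(m, n)) : `|frob A B| <= normF A * normF B.
Proof.
rewrite -ler_sqr ?nnegrE ?mulr_ge0 ?normF_ge0//.
by rewrite real_normK ?num_real// exprMn !normF_sqr frob_CauchySchwarz.
Qed.

Lemma normFD m n (A B : 'M[R]_(m, n)) : normF (A + B) <= normF A + normF B.
Proof.
rewrite normF_leP ?addr_ge0 ?normF_ge0// frobDl !frobDr (frobC B A).
rewrite sqrrD !normF_sqr.
have := le_trans (ler_norm _) (frob_le A B); lra.
Qed.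

Lemma normFZ m n a (A : 'M[R]_(m, n)) : normF (a *: A) = `|a| * normF A.
Proof.
apply/eqP; rewrite -(eqrXn2 (n := 2)) ?normF_ge0 ?mulr_ge0 ?normF_ge0//.
by rewrite exprMn real_normK ?num_real// !normF_sqr frobZl frobZr mulrA.
Qed.

Lemma normFN m n (A : 'M[R]_(m, n)) : normF (- A) = normF A.
Proof. by rewrite -scaleN1r normFZ normrN1 mul1r. Qed.

Lemma normF_tr m n (A : 'M[R]_(m, n)) : normF A^T = normF A.
Proof.
apply/eqP; rewrite -(eqrXn2 (n := 2)) ?normF_ge0// !normF_sqr /frob trmxK.
by rewrite mxtrace_mulC.
Qed.

Lemma normF_col m n (A : 'M[R]_(m, n)) :
  normF A ^+ 2 = \sum_j normF (col j A) ^+ 2.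
Proof.
rewrite normF_sqr frobE exchange_big; apply: eq_bigr => j _.
by rewrite normF_sqr frobE; apply: eq_bigr => i _; rewrite big_ord1 !mxE.
Qed.

Lemma normF_abs m n (A : 'M[R]_(m, n)) : normF (absmx A) = normF A.
Proof.
apply/eqP; rewrite -(eqrXn2 (n := 2)) ?normF_ge0// !normF_sqr !frobE.
apply/eqP; do 2!apply: eq_bigr => ? _.
by rewrite !mxE -normrM -expr2 ger0_norm// sqr_ge0.
Qed.

Lemma normF_le_lemx m n (A B : 'M[R]_(m, n)) :
  lemx (absmx A) B -> normF A <= normF B.
Proof.
move=> AB; rewrite normF_leP ?normF_ge0// normF_sqr !frobE.
apply: ler_sum => i _; apply: ler_sum => j _.
rewrite -!expr2 -(real_normK (num_real (A _ _))).
have := AB i j; rewrite mxE => ABij.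
by rewrite lerXn2r ?nnegrE// (le_trans _ ABij).
Qed.

Lemma frob1l n (A : 'M[R]_n) : frob 1%:M A = \tr A.
Proof. by rewrite /frob trmx1 mul1mx. Qed.

Lemma normF1_sqr n : normF (1%:M : 'M[R]_n) ^+ 2 = n%:R.
Proof. by rewrite normF_sqr frob1l mxtrace1. Qed.

Lemma normF1 n : normF (1%:M : 'M[R]_n) = Num.sqrt n%:R.
Proof. by rewrite -normF1_sqr sqrtr_sqr ger0_norm ?normF_ge0. Qed.

Lemma mxtrace_le n (A : 'M[R]_n) : `|\tr A| <= Num.sqrt n%:R * normF A.
Proof. by rewrite -frob1l -normF1 frob_le. Qed.

Lemma mxtrace_gram m n (A : 'M[R]_(m, n)) : \tr (A^T *m A) = normF A ^+ 2.
Proof. by rewrite normF_sqr. Qed.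

Lemma frob_quad n (A : 'M[R]_n) m (B : 'M[R]_(n, m)) c :
  normF (A *m B) <= c * normF B -> `|frob B (A *m B)| <= c * normF B ^+ 2.
Proof.
move=> h; apply: (le_trans (frob_le _ _)).
by rewrite expr2 mulrCA ler_wpM2l ?normF_ge0.
Qed.

End FrobeniusProduct.

(** Only upper bounds on the spectral norm enter the estimates, so the supremum in [norm2] is
    avoided; [norm2_op_le] links the two. *)
Definition op_le (R : realType) m n (A : 'M[R]_(m, n)) (c : R) : Prop :=
  forall v : 'cV[R]_n, normF (A *m v) <= c * normF v.

Section OperatorBounds.
Variable R : realType.

(** The squared Frobenius norm is a sum over columns, and the operator bound applies to each.
    Measuring one factor in operator norm saves factors sqrt(n) later. *)
Lemma op_le_mull m k n (A : 'M[R]_(m, k)) c (B : 'M[R]_(k, n)) :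
  0 <= c -> op_le A c -> normF (A *m B) <= c * normF B.
Proof.
move=> c0 Ac; rewrite -ler_sqr ?nnegrE ?mulr_ge0 ?normF_ge0//.
rewrite exprMn !normF_col mulr_sumr; apply: ler_sum => j _.
rewrite colE -mulmxA -colE -exprMn lerXn2r ?nnegrE ?mulr_ge0 ?normF_ge0//.
Qed.

(** |A^T v|^2 = <v, A A^T v> <= |v| c |A^T v|, and a nonzero |A^T v| cancels. *)
Lemma op_le_tr m n (A : 'M[R]_(m, n)) c : 0 <= c -> op_le A c -> op_le A^T c.
Proof.
move=> c0 Ac v; have [->|N0] := eqVneq (A^T *m v) 0.
  have -> : normF (0 : 'cV[R]_n) = 0 by apply/eqP; rewrite normF_eq0.
  by rewrite mulr_ge0 ?normF_ge0.
rewrite -normF_gt0 in N0; rewrite -(ler_pM2r N0) -expr2 normF_sqr frob_mull trmxK.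
apply: (le_trans (ler_norm _)); apply: (le_trans (frob_le _ _)).
by rewrite -mulrA mulrCA ler_wpM2l ?normF_ge0.
Qed.

Lemma op_le_mulr m k n (A : 'M[R]_(k, n)) c (B : 'M[R]_(m, k)) :
  0 <= c -> op_le A c -> normF (B *m A) <= c * normF B.
Proof.
move=> c0 Ac; rewrite -normF_tr trmx_mul -(normF_tr B).
exact: op_le_mull (op_le_tr c0 Ac).
Qed.

(** Cauchy-Schwarz on each row of [A] makes [normF A] an operator bound; [op_le_mull] then treats
    the columns of [B]. *)
Lemma normF_mulmx m k n (A : 'M[R]_(m, k)) (B : 'M[R]_(k, n)) :
  normF (A *m B) <= normF A * normF B.
Proof.
have row_le p (u : 'rV[R]_p) (v : 'cV[R]_p) : normF (u *m v) <= normF u * normF v.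
  have -> : normF (u *m v) = `|frob u^T v|.
    rewrite /frob trmxK /mxtrace big_ord1 -sqrtr_sqr /normF.
    by rewrite !big_ord1.
  by rewrite (le_trans (frob_le _ _))// normF_tr.
have op_leF : op_le A (normF A).
  move=> v; rewrite -ler_sqr ?nnegrE ?mulr_ge0 ?normF_ge0//.
  rewrite exprMn -(normF_tr (A *m v)) -(normF_tr A) (normF_col A^T).
  rewrite normF_col mulr_suml.
  apply: ler_sum => i _; rewrite -exprMn lerXn2r ?nnegrE ?mulr_ge0 ?normF_ge0//.
  by rewrite -!tr_row !normF_tr row_mul row_le.
by apply: op_le_mull => //; exact: normF_ge0.
Qed.

Lemma op_le_normF m n (A : 'M[R]_(m, n)) : op_le A (normF A).
Proof. by move=> v; exact: normF_mulmx. Qed.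

Lemma op_le_normF_le n m (A : 'M[R]_(m, n)) c :
  0 <= c -> op_le A c -> normF A <= c * Num.sqrt n%:R.
Proof. by move=> c0 /(op_le_mull 1%:M c0); rewrite mulmx1 normF1. Qed.

(** The difference of squares is the quadratic form of T^T T - A^T A at v. *)
Lemma gram_perturb m k n (A : 'M[R]_(m, n)) (T : 'M[R]_(k, n)) e (v : 'cV[R]_n) :
  normF (T^T *m T - A^T *m A) <= e ->
  `|normF (T *m v) ^+ 2 - normF (A *m v) ^+ 2| <= e * normF v ^+ 2.
Proof.
move=> eE; rewrite !normF_sqr !frob_mull !mulmxA.
have -> (C D : 'M[R]_n) : frob v (C *m v) - frob v (D *m v) = frob v ((C - D) *m v).
  by rewrite mulmxBl frobDr -[- (D *m v)]scaleN1r frobZr mulN1r.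
apply: (le_trans (frob_quad (normF_mulmx _ _))).
by rewrite -normF_sqr ler_wpM2r ?sqr_ge0.
Qed.

End OperatorBounds.

(** * Extremal singular values *)

Section ExtremalSingularValues.
Variable R : realType.

Lemma op_leP m n (A : 'M[R]_(m, n)) c :
  (forall v : 'cV[R]_n, normF v = 1 -> normF (A *m v) <= c) -> op_le A c.
Proof.
move=> Ac v; have [->|v0] := eqVneq v 0.
  by rewrite mulmx0 (eqP (_ : normF 0 == 0)) ?normF_eq0// (eqP (_ : normF 0 == 0))
    ?normF_eq0// mulr0.
rewrite -normF_gt0 in v0; rewrite -ler_pdivrMr// mulrC.
rewrite -[X in X * _]ger0_norm ?invr_ge0 ?normF_ge0// -normFZ scalemxAr.
apply: Ac; rewrite normFZ ger0_norm ?invr_ge0 ?normF_ge0//.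
by rewrite mulVf// gt_eqF.
Qed.

Lemma norm2_op_le m n (A : 'M[R]_(m, n)) : op_le A (norm2 A).
Proof.
apply: op_leP => v v1; apply: ub_le_sup; last by exists v.
exists (normF A) => _ [w /= w1 <-].
by rewrite (le_trans (op_le_normF _ _))// w1 mulr1.
Qed.

Lemma norm2_gt0 m n (A : 'M[R]_(m, n)) : A != 0 -> 0 < norm2 A.
Proof.
move=> A0; rewrite ltNge; apply: contra A0 => A2.
rewrite -normF_eq0 -sqrf_eq0 normF_col psumr_eq0; last by move=> *; exact: sqr_ge0.
apply/allP => j _; rewrite sqrf_eq0 eq_le normF_ge0 andbT colE.
by rewrite (le_trans (norm2_op_le _ _))// mulr_le0_ge0 ?normF_ge0.
Qed.

(* Nonnegativity of the form at [v - t *: A *m v], with [t := (normF A)^-1]. *)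
Lemma psd_sqr_normF_le n (A : 'M[R]_n) (v : 'cV[R]_n) :
  A^T = A -> (forall w : 'cV[R]_n, 0 <= frob w (A *m w)) ->
  normF (A *m v) ^+ 2 <= normF A * frob v (A *m v).
Proof.
move=> At A_psd; have [->|A0] := eqVneq A 0.
  by rewrite !mul0mx normF_sqr /frob !mulmx0 mxtrace0 mulr0.
rewrite -normF_gt0 in A0.
set w := A *m v; have := A_psd (v - (normF A)^-1 *: w).
have := ler_norm (frob w (A *m w)).
have /(@frob_quad _ _ A _ w) := normF_mulmx A w.
move=> /[swap] /le_trans /[apply]; set q := frob w (A *m w) => qw.
rewrite mulmxBr -/w -scalemxAr !(frobDl, frobDr) -!scaleNr !(frobZl, frobZr) -/q.
have -> : frob v (A *m w) = frob w w by rewrite -{1}At -frob_mull.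
rewrite -normF_sqr; set N := normF A in A0 qw *; set W := normF w ^+ 2.
move=> h; rewrite -ler_pdivrMl//.
have N2 : N^-1 * N^-1 * q <= N^-1 * W.
  rewrite -mulrA ler_wpM2l ?invr_ge0 ?(ltW A0)// ler_pdivrMl//.
lra.
Qed.

Variables (m n : nat) (X : 'M[R]_(m, n)).
Hypotheses (n_gt0 : (0 < n)%N) (rankX : \rank X = n).

(** The infimum of these Rayleigh quotients is shown to be sigma_min(X)^2, with no appeal to
    compactness of the unit sphere. *)
Let rayleigh : set R :=
  [set normF (X *m v) ^+ 2 | v in [set v : 'cV[R]_n | normF v = 1]].

Let rayleigh_neq0 : rayleigh !=set0.
Proof.
pose v : 'cV[R]_n := delta_mx (Ordinal n_gt0) 0.
exists (normF (X *m v) ^+ 2), v => //=.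
apply/eqP; rewrite -(eqrXn2 (n := 2)) ?normF_ge0// normF_sqr /v /frob.
by rewrite trmx_delta mul_delta_mx /mxtrace big_ord1 mxE !eqxx expr1n.
Qed.

Let rayleigh_ge0 : lbound rayleigh 0.
Proof. by move=> _ [v _ <-]; exact: sqr_ge0. Qed.

Let min_rayleigh_le (v : 'cV[R]_n) :
  inf rayleigh * normF v ^+ 2 <= normF (X *m v) ^+ 2.
Proof.
have [->|v0] := eqVneq v 0.
  by rewrite mulmx0 !normF_sqr /frob !mulmx0 !mxtrace0 mulr0.
rewrite -normF_gt0 in v0; rewrite -ler_pdivlMr ?exprn_gt0//.
apply: ge_inf; first by exists 0; exact: rayleigh_ge0.
exists ((normF v)^-1 *: v) => /=.
  by rewrite normFZ ger0_norm ?invr_ge0 ?normF_ge0// mulVf// gt_eqF.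
rewrite -scalemxAr normFZ ger0_norm ?invr_ge0 ?normF_ge0//.
by rewrite exprMn exprVn mulrC.
Qed.

(** Full column rank yields B with B X = I, hence |v| <= |B|_F |X v|, and every quotient is at least
    |B|_F^-2. *)
Let min_rayleigh_gt0 : 0 < inf rayleigh.
Proof.
have /row_fullP[B BX] : row_full X by rewrite /row_full rankX.
have vX (v : 'cV[R]_n) : normF v <= normF B * normF (X *m v).
  by rewrite -{1}(mul1mx v) -BX -mulmxA normF_mulmx.
have [_ [v0 /= v01 _]] := rayleigh_neq0.
have B0 : 0 < normF B.
  rewrite lt_neqAle normF_ge0 andbT; apply/eqP => B0.
  by have := vX v0; rewrite -B0 mul0r v01 ler10.
apply: (@lt_le_trans _ _ ((normF B)^-1 ^+ 2)); first by rewrite exprn_gt0 ?invr_gt0.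
apply: lb_le_inf => // _ [v /= v1 <-].
rewrite lerXn2r ?nnegrE ?invr_ge0 ?normF_ge0//.
by rewrite -div1r ler_pdivrMr// mulrC -v1.
Qed.

(** Otherwise A = X^T X - inf I is invertible and positive semidefinite. On the unit sphere 1 <=
    |A^-1|_F^2 |A v|^2 <= K <v, A v>, so every quotient exceeds the infimum by at least 1/K, a
    contradiction. *)
Let min_rayleigh_eigenvalue : eigenvalue (X^T *m X) (inf rayleigh).
Proof.
rewrite /eigenvalue /eigenspace kermx_eq0 row_free_unit.
set A := _ - _; apply/negP => Au.
have A_form (v : 'cV[R]_n) :
    frob v (A *m v) = normF (X *m v) ^+ 2 - inf rayleigh * normF v ^+ 2.
  rewrite mulmxBl frobDr -[- (_ *m v)]scaleN1r frobZr mul_scalar_mx frobZr.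
  by rewrite mulN1r !normF_sqr frob_mull mulmxA.
have A_psd (v : 'cV[R]_n) : 0 <= frob v (A *m v).
  by rewrite A_form subr_ge0 min_rayleigh_le.
have At : A^T = A.
  by rewrite /A linearB/= trmx_mul trmxK tr_scalar_mx.
pose K := normF (invmx A) ^+ 2 * normF A.
have vK (v : 'cV[R]_n) : normF v = 1 ->
    1 <= K * (normF (X *m v) ^+ 2 - inf rayleigh).
  move=> v1; have := A_form v; rewrite v1 expr1n mulr1 => <-.
  rewrite /K -mulrA; apply: le_trans (ler_wpM2l (sqr_ge0 _) (psd_sqr_normF_le v At A_psd)).
  rewrite -exprMn -(expr1n _ 2) lerXn2r ?nnegrE ?mulr_ge0 ?normF_ge0//.
  by rewrite -{1}v1 -{1}(mulKmx Au v) normF_mulmx.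
have [_ [v0 /= v01 _]] := rayleigh_neq0.
have K0 : 0 < K.
  rewrite lt_neqAle mulr_ge0 ?sqr_ge0 ?normF_ge0// andbT.
  by apply/eqP => K0; have := vK _ v01; rewrite -K0 mul0r ler10.
have : inf rayleigh + K^-1 <= inf rayleigh.
  apply: lb_le_inf => // _ [v /= v1 <-].
  by rewrite addrC -lerBrDr -div1r ler_pdivrMr// mulrC vK.
by rewrite gerDl invr_le0 leNgt K0.
Qed.

Lemma singular_value_rayleigh s :
  singular_value X s -> inf rayleigh <= s ^+ 2.
Proof.
move=> [s0 /eigenvalueP[v vX v0]].
have v2 : 0 < normF v^T by rewrite normF_tr normF_gt0.
rewrite -(ler_pM2r (exprn_gt0 2 v2)) (le_trans (min_rayleigh_le _))//.
(* [eigenvalue] speaks of row vectors; as X^T X is symmetric, the transpose is a column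
   eigenvector. *)
have XXv : X^T *m (X *m v^T) = s ^+ 2 *: v^T.
  by apply: trmx_inj; rewrite !trmx_mul !trmxK -mulmxA vX linearZ/= trmxK.
by rewrite !normF_sqr frob_mull XXv frobZr.
Qed.

Lemma sigma_minE : sigma_min X = Num.sqrt (inf rayleigh).
Proof.
have sv : singular_value X (Num.sqrt (inf rayleigh)).
  split; first exact: sqrtr_ge0.
  by rewrite sqr_sqrtr ?(ltW min_rayleigh_gt0)// min_rayleigh_eigenvalue.
apply/eqP; rewrite eq_le; apply/andP; split.
  by apply: ge_inf => //; exists 0 => s [].
apply: lb_le_inf; first by exists (Num.sqrt (inf rayleigh)).
move=> s sX; rewrite -(ger0_norm (proj1 sX)) -sqrtr_sqr.
by rewrite ler_wsqrtr// singular_value_rayleigh.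
Qed.

Lemma sigma_min_gt0 : 0 < sigma_min X.
Proof. by rewrite sigma_minE sqrtr_gt0 min_rayleigh_gt0. Qed.

Lemma sigma_min_le (v : 'cV[R]_n) : sigma_min X * normF v <= normF (X *m v).
Proof.
rewrite -ler_sqr ?nnegrE ?mulr_ge0 ?normF_ge0 ?(ltW sigma_min_gt0)//.
by rewrite exprMn sigma_minE sqr_sqrtr ?(ltW min_rayleigh_gt0)// min_rayleigh_le.
Qed.

End ExtremalSingularValues.

(** * One CholeskyQR step *)

Lemma ler_of_sqr (R : realDomainType) (a x y : R) :
  0 <= a -> 0 <= y -> x ^+ 2 <= a ^+ 2 * y ^+ 2 -> x <= a * y.
Proof.
move=> a0 y0 xy; apply: (le_trans (ler_norm _)).
rewrite -ler_sqr ?nnegrE ?normr_ge0 ?(mulr_ge0 a0 y0)//.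
by rewrite real_normK ?num_real// exprMn.
Qed.

Section CholeskyQR.
Variable R : realType.

Lemma lemx_normF_le m k n (E : 'M[R]_(m, n)) (A : 'M[R]_(m, k))
    (B : 'M[R]_(k, n)) g :
  0 <= g -> lemx (absmx E) (g *: (absmx A *m absmx B)) ->
  normF E <= g * (normF A * normF B).
Proof.
move=> g0 /normF_le_lemx /le_trans; apply; rewrite normFZ ger0_norm//.
by rewrite ler_wpM2l// -(normF_abs A) -(normF_abs B) normF_mulmx.
Qed.

(** Only diagonal entries enter, and tr(|A|^T |A|) is exactly |A|_F^2; passing through [mxtrace_le]
    would cost a factor sqrt(n). *)
Lemma lemx_mxtrace_le m n (E : 'M[R]_n) (A : 'M[R]_(m, n)) g :
  lemx (absmx E) (g *: (absmx A^T *m absmx A)) -> `|\tr E| <= g * normF A ^+ 2.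
Proof.
move=> EA; apply: (le_trans (ler_norm_sum _ _ _)).
rewrite -normF_abs -mxtrace_gram -mxtraceZ; apply: ler_sum => i _.
by have := EA i i; rewrite {1}mxE /absmx map_trmx.
Qed.

Lemma fl_cholesky_unitmx n (G T : 'M[R]_n) : fl_cholesky G T -> T \in unitmx.
Proof.
move=> [Tu T0 _]; rewrite -unitmx_tr unitmxE det_trig// unitfE gt_eqF//.
by apply: prodr_gt0 => i _; rewrite mxE.
Qed.

Section Gram.
Variables (m n : nat) (A : 'M[R]_(m, n)) (G T : 'M[R]_n) (g h : R).
Hypotheses (g_ge0 : 0 <= g) (h_ge0 : 0 <= h) (h_lt1 : h < 1).
Hypothesis GA : lemx (absmx (G - A^T *m A)) (g *: (absmx A^T *m absmx A)).
Hypothesis TG : lemx (absmx (T^T *m T - G)) (h *: (absmx T^T *m absmx T)).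

(** Traces turn the two backward errors into |T|_F^2 <= tr G + h |T|_F^2 and tr G <= (1 + g)
    |A|_F^2; as h < 1, the term in T is absorbed. *)
Lemma cholesky_sqr_normF_le : normF T ^+ 2 <= (1 + g) / (1 - h) * normF A ^+ 2.
Proof.
have := le_trans (ler_norm _) (lemx_mxtrace_le GA).
have := le_trans (ler_norm _) (lemx_mxtrace_le TG).
rewrite !linearB/= !mxtrace_gram => T1 G1.
rewrite mulrAC ler_pdivlMr ?subr_gt0//; lra.
Qed.

Lemma cholesky_gram_le :
  normF (T^T *m T - A^T *m A) <= (g + h * ((1 + g) / (1 - h))) * normF A ^+ 2.
Proof.
have := lemx_normF_le g_ge0 GA; have := lemx_normF_le h_ge0 TG.
rewrite !normF_tr -!expr2 => T1 G1.
have -> : T^T *m T - A^T *m A = (T^T *m T - G) + (G - A^T *m A).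
  by rewrite addrA subrK.
apply: (le_trans (normFD _ _)); rewrite mulrDl addrC lerD//.
by apply: (le_trans T1); rewrite -mulrA ler_wpM2l// cholesky_sqr_normF_le.
Qed.

End Gram.

Section Step.
Variables (m n : nat) (A V : 'M[R]_(m, n)) (T : 'M[R]_n) (e k s : R).
Hypotheses (s_gt0 : 0 < s) (k_ge0 : 0 <= k).
Hypothesis A_ge : forall v : 'cV[R]_n, s * normF v <= normF (A *m v).
Hypothesis TA : normF (T^T *m T - A^T *m A) <= e.
Hypothesis e_le : 24 * e <= s ^+ 2.
Hypothesis Tu : T \in unitmx.
Hypothesis VT : normF (V *m T - A) <= k * (normF V * normF T).

(** The absolute error e |v|^2 becomes relative to |A v|^2, since 24 e <= s^2 and s |v| <= |A v|. *)
Let gram_le (v : 'cV[R]_n) :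
  24 * `|normF (T *m v) ^+ 2 - normF (A *m v) ^+ 2| <= normF (A *m v) ^+ 2.
Proof.
have h1 := gram_perturb v TA.
have h2 : (s * normF v) ^+ 2 <= normF (A *m v) ^+ 2.
  by rewrite lerXn2r ?nnegrE ?mulr_ge0 ?normF_ge0 ?(ltW s_gt0).
rewrite exprMn in h2; have v2 := sqr_ge0 (normF v).
have := ler_wpM2r v2 e_le; lra.
Qed.

Lemma cholesky_op_le (c : R) : 0 <= c -> op_le A c -> op_le T (1021 / 1000 * c).
Proof.
move=> c0 Ac v; rewrite -[leRHS]mulrA.
apply: (@le_trans _ _ (1021 / 1000 * normF (A *m v))); last first.
  by apply: ler_wpM2l; [lra|exact: Ac].
(* 1021/1000 exceeds sqrt(25/24). *)
apply: ler_of_sqr; [lra|exact: normF_ge0|].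
have := gram_le v; have := sqr_ge0 (normF (A *m v)).
have := ler_norm (normF (T *m v) ^+ 2 - normF (A *m v) ^+ 2); lra.
Qed.

Let A_le (v : 'cV[R]_n) : normF (A *m v) <= 103 / 100 * normF (T *m v).
Proof.
(* 103/100 exceeds sqrt(24/23). *)
apply: ler_of_sqr; [lra|exact: normF_ge0|].
have := gram_le v; have := sqr_ge0 (normF (A *m v)).
have := ler_norm (- (normF (T *m v) ^+ 2 - normF (A *m v) ^+ 2)).
rewrite normrN; lra.
Qed.

Let AT_op_le : op_le (A *m invmx T) (103 / 100).
Proof. by move=> v; rewrite -mulmxA (le_trans (A_le _))// mulKVmx. Qed.

Let T_op_le : op_le (invmx T) (103 / 100 / s).
Proof.
move=> v; rewrite mulrAC ler_pdivlMr// mulrC.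
by rewrite (le_trans (A_ge _))// (le_trans (A_le _))// mulKVmx.
Qed.

Let c103 : 0 <= 103 / 100 :> R. Proof. lra. Qed.
Let c103s : 0 <= 103 / 100 / s. Proof. by rewrite divr_ge0// ltW. Qed.

(** The scale of |V - A T^-1|_F: the backward error k |V|_F |T|_F, with |V|_F about sqrt(n), times
    the norm of T^-1, about 1/s. *)
Let tau : R := k * normF T / s * Num.sqrt n%:R.
Hypothesis tau_le : 58 * tau <= 1.
Hypothesis n_gt0 : (0 < n)%N.

(* [V *m T = A + D] gives [V = A *m invmx T + D *m invmx T]; the first summand
   is nearly orthonormal because [T^T *m T] is close to [A^T *m A]. *)
Lemma choleskyqr_orthogonality :
  normF (V^T *m V - 1%:M) <= 107 / 100 * (e / s ^+ 2) + 9 / 4 * tau.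
Proof.
set B := A *m invmx T; set P := V - B; pose rho : R := normF P.
have sqn : 1 <= Num.sqrt (n%:R : R) by rewrite -{1}sqrtr1 ler_wsqrtr// ler1n.
have B_le : normF B <= 103 / 100 * Num.sqrt n%:R.
  exact: op_le_normF_le AT_op_le.
have V_le : normF V <= rho + 103 / 100 * Num.sqrt n%:R.
  by rewrite -(subrK B V) (le_trans (normFD _ _))// lerD2l.
pose q := k * normF T / s.
have q0 : 0 <= q by rewrite !mulr_ge0 ?normF_ge0 ?invr_ge0 ?(ltW s_gt0).
have rho_le : rho <= 103 / 100 * q * normF V.
  have -> : rho = normF ((V *m T - A) *m invmx T) by rewrite mulmxBl mulmxK.
  apply: (le_trans (op_le_mulr _ c103s T_op_le)).
  apply: (le_trans (ler_wpM2l c103s VT)).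
  by rewrite le_eqVlt; apply/orP; left; apply/eqP; rewrite /q; ring.
have qtau : q <= tau by rewrite ler_peMr.
have tau0 : 0 <= tau by rewrite (le_trans q0).
have rho0 : 0 <= rho := normF_ge0 _.
(* |V|_F is bounded through [rho] itself; the resulting [q * rho] on the right is absorbed because
   58 q <= 58 tau <= 1. *)
have rho_tau : rho <= 1081 / 1000 * tau.
  have h1 : q * normF V <= q * rho + 103 / 100 * tau.
    by rewrite (le_trans (ler_wpM2l q0 V_le))// mulrDr lerD2l mulrCA.
  have h2 : 58 * (q * rho) <= rho.
    by rewrite mulrA -[leRHS]mul1r ler_wpM2r// (le_trans _ tau_le)//; lra.
  lra.
have Bo : normF (B^T *m B - 1%:M) <= 103 / 100 / s * (103 / 100 / s * e).
  have -> : B^T *m B - 1%:M = - ((invmx T)^T *m (T^T *m T - A^T *m A) *m invmx T).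
    rewrite mulmxBr mulmxBl opprB /B trmx_mul !mulmxA; congr (_ - _).
    by rewrite trmx_inv mulVmx ?unitmx_tr// mul1mx mulmxV.
  rewrite normFN (le_trans (op_le_mulr _ c103s T_op_le))// ler_wpM2l//.
  by rewrite (le_trans (op_le_mull _ c103s (op_le_tr c103s T_op_le)))// ler_wpM2l.
have BP : normF (B^T *m P) <= 103 / 100 * rho.
  exact: op_le_mull (op_le_tr c103 AT_op_le).
have gramD (C D : 'M[R]_(m, n)) : (C + D)^T *m (C + D) - 1%:M =
    (D^T *m D - 1%:M) + (D^T *m C + (D^T *m C)^T) + C^T *m C.
  rewrite trmx_mul trmxK [(C + D)^T]linearD/= mulmxDl !mulmxDr.
  by rewrite [LHS](AC (2 * 2 * 1) (4 * 5 * (3 * 2) * 1)).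
rewrite -(subrK B V) -/P gramD.
have PP : normF (P^T *m P) <= rho * rho.
  by rewrite (le_trans (normF_mulmx _ _))// normF_tr.
have rr : rho * rho <= 1081 / 1000 / 58 * rho.
  have rho_le1 : rho <= 1081 / 1000 / 58 by have := tau_le; lra.
  exact: ler_wpM2r.
clearbody P.
(* The final constants: (103/100)^2 <= 107/100 for the Gram error, and 2 (1.03) (1.081) + 1.081^2 /
   58 <= 9/4 for the cross terms and P^T P. *)
have := normFD (B^T *m B - 1%:M + (B^T *m P + (B^T *m P)^T)) (P^T *m P).
have := normFD (B^T *m B - 1%:M) (B^T *m P + (B^T *m P)^T).
have := normFD (B^T *m P) (B^T *m P)^T; rewrite normF_tr.
have es : 0 <= e / s ^+ 2.
  by rewrite divr_ge0 ?sqr_ge0// (le_trans _ TA)// normF_ge0.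
have ees : 103 / 100 / s * (103 / 100 / s * e) = (103 / 100) ^+ 2 * (e / s ^+ 2).
  by rewrite -exprVn; ring.
rewrite ees in Bo; have := tau_le; lra.
Qed.

End Step.

End CholeskyQR.

(** * CholeskyQR2 from a given first Gram matrix *)

Section Constants.
Variable R : realType.

Lemma uroundoff_gt0 : 0 < uroundoff :> R.
Proof. by rewrite invr_gt0 exprn_gt0. Qed.

Lemma uroundoff_le : uroundoff <= 2 ^- 20 :> R.
Proof.
have p k : 0 < 2 ^+ k :> R by exact: exprn_gt0.
by rewrite /uroundoff lef_pV2 ?posrE ?p// ler_weXn2l// ler1n.
Qed.

Lemma gamma_ge0 k : k%:R * uroundoff <= 1 :> R -> 0 <= gamma k :> R.
Proof.
move=> k1; rewrite divr_ge0 ?mulr_ge0 ?ler0n ?(ltW uroundoff_gt0)//.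
by rewrite subr_ge0.
Qed.

Lemma gamma_le k (c : R) :
  k%:R * uroundoff <= c -> c < 1 -> gamma k * (1 - c) <= k%:R * uroundoff.
Proof.
move=> kc c1; have k1 : 0 < 1 - k%:R * uroundoff :> R.
  by rewrite subr_gt0 (le_lt_trans kc).
rewrite /gamma mulrAC ler_pdivrMr// ler_wpM2l ?lerB//.
by rewrite mulr_ge0 ?ler0n ?(ltW uroundoff_gt0).
Qed.

End Constants.

Lemma lemx_absB (R : numDomainType) m n (A B C : 'M[R]_(m, n)) :
  lemx (absmx (A - B)) C -> lemx (absmx (B - A)) C.
Proof. by move=> AB i j; have := AB i j; rewrite !mxE distrC. Qed.

Lemma near_orthonormal (R : realType) m n (V : 'M[R]_(m, n)) e (v : 'cV[R]_n) :
  normF (V^T *m V - 1%:M) <= e ->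
  `|normF (V *m v) ^+ 2 - normF v ^+ 2| <= e * normF v ^+ 2.
Proof.
move=> Ve; rewrite -[in X in _ - X](mul1mx v); apply: gram_perturb.
by rewrite trmx1 mul1mx.
Qed.

Section CholeskyQR2.
Variables (R : realType) (m n : nat) (X : 'M[R]_(m, n)).
Hypotheses (n_gt0 : (0 < n)%N) (rankX : \rank X = n).

(** [w] stands for eta sqrt(m) u and [g] for the randomized constant of the first Gram product;
    everything in this section is deterministic. *)
Variables (u w g : R).
Hypothesis uE : u = uroundoff.

Local Notation N := (n%:R : R).
Local Notation M := (m%:R : R).

Hypotheses (w_ge0 : 0 <= w) (w_le : 64 * w <= 1) (g_ge0 : 0 <= g).
Hypothesis g_le : g <= 1017 / 1000 * w + 1 / 50 * u.
Hypothesis mn_le : M * N * u <= 1 / 64.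
Hypothesis nn_le : N * (N + 1) * u <= 1 / 64.
Hypothesis cond_le :
  64 * (normF X / sigma_min X) ^+ 2 * (w + (N + 1) * u) <= 1.

Let u0 : 0 < u. Proof. by rewrite uE; exact: uroundoff_gt0. Qed.
Let n1 : 1 <= N. Proof. by rewrite ler1n. Qed.

(* [((n + 1) u)^2 <= 2 n (n + 1) u^2 <= u / 32] *)
Let n1u : (N + 1) * u <= 1 / 4000.
Proof.
have a0 : 0 <= (N + 1) * u by rewrite mulr_ge0 ?addr_ge0 ?(ltW u0).
rewrite -[leRHS]mulr1; apply: ler_of_sqr; [lra|exact: ler01|].
have h1 := ler_wpM2r (ltW u0) nn_le.
have h2 : u <= 2 ^- 20 by rewrite uE uroundoff_le.
have h3 : 0 <= (N - 1) * ((N + 1) * u * u).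
  by rewrite mulr_ge0 ?subr_ge0 ?(mulr_ge0 a0)// ltW.
lra.
Qed.

Let h := gamma n.+1 : R.
Let nS : n.+1%:R * uroundoff <= 1 / 4000 :> R.
Proof. by rewrite -[n.+1%:R]natr1 -uE. Qed.
Let h0 : 0 <= h. Proof. by apply: gamma_ge0; have := nS; lra. Qed.
Let h_le : h <= 1001 / 1000 * ((N + 1) * u).
Proof.
have c1 : 1 / 4000 < 1 :> R by lra.
by have := gamma_le nS c1; rewrite -/h -[n.+1%:R]natr1 -uE; have := h0; lra.
Qed.
Let h1 : h < 1. Proof. by have := h_le; have := n1u; lra. Qed.

Let k := gamma n : R.
Let nu : N * uroundoff <= 1 / 4000.
Proof. by rewrite -uE; have := n1u; have := u0; lra. Qed.
Let k0 : 0 <= k. Proof. by apply: gamma_ge0; have := nu; lra. Qed.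
Let k_le : k <= 1001 / 1000 * (N * u).
Proof.
have c1 : 1 / 4000 < 1 :> R by lra.
by have := gamma_le nu c1; rewrite -/k -uE; have := k0; lra.
Qed.

Let gm := gamma m : R.
Let mu : M * uroundoff <= 1 / 64.
Proof.
rewrite -uE; apply: le_trans mn_le.
by rewrite mulrAC ler_peMr ?mulr_ge0 ?ler0n ?(ltW u0).
Qed.
Let gm0 : 0 <= gm. Proof. by apply: gamma_ge0; have := mu; lra. Qed.
Let gm_le : gm <= 1016 / 1000 * (M * u).
Proof.
have c1 : 1 / 64 < 1 :> R by lra.
by have := gamma_le mu c1; rewrite -/gm -uE; have := gm0; lra.
Qed.

Let sqn : R := Num.sqrt N.
Let sqn2 : sqn * sqn = N. Proof. by rewrite -expr2 sqr_sqrtr ?ler0n. Qed.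
Let sqn1 : 1 <= sqn. Proof. by rewrite -[leLHS]sqrtr1 ler_wsqrtr. Qed.

Let sqn0 : 0 <= sqn. Proof. exact: sqrtr_ge0. Qed.

Let nnu : N * N * u <= N * (N + 1) * u.
Proof. by have := u0; have := n1; nra. Qed.

Let s : R := sigma_min X.
Let s0 : 0 < s. Proof. exact: sigma_min_gt0. Qed.
Let x : R := normF X.
Let x0 : 0 <= x. Proof. exact: normF_ge0. Qed.
Let r : R := x / s.
Let r0 : 0 <= r. Proof. by rewrite divr_ge0 ?(ltW s0). Qed.

Let quot_le (a : R) : 0 <= a -> a <= 1 / 60 ->
  (1 + a) / (1 - h) <= 10003 / 10000 * (1 + a).
Proof.
move=> a0 a1; rewrite ler_pdivrMr ?subr_gt0//.
have b0 : 0 <= 1 + a by lra.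
have c1 : 1 <= 10003 / 10000 * (1 - h) by have := h_le; have := n1u; lra.
by have := ler_wpM2r b0 c1; lra.
Qed.

Let g1 : g <= 1 / 60.
Proof. by have := g_le; have := w_le; have := n1u; have := n1; have := u0; nra. Qed.

Variables (G : 'M[R]_n) (W : 'M[R]_(m, n)) (Y : 'M[R]_n).
Hypothesis GX : lemx (absmx (G - X^T *m X)) (g *: (absmx X^T *m absmx X)).
Hypothesis XWY : fl_choleskyqr_from G X W Y.

Let Y_le : normF Y <= 101 / 100 * x.
Proof.
have [[_ _ YG] _] := XWY.
apply: ler_of_sqr; [lra|exact: x0|].
apply: (le_trans (cholesky_sqr_normF_le h1 GX YG)).
rewrite ler_wpM2r ?sqr_ge0//.
by have := quot_le g_ge0 g1; have := g1; lra.
Qed.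

Let e : R := (g + h * ((1 + g) / (1 - h))) * x ^+ 2.

(** Here the condition delta_1 <= 1 enters, squared: with r = |X|_F / sigma_min(X), it bounds r^2 (w
    + (n + 1) u) by 1/64, and rounding constants account for 103/100. *)
Let e_le : e / s ^+ 2 <= 103 / 100 / 64.
Proof.
have -> : e / s ^+ 2 = (g + h * ((1 + g) / (1 - h))) * r ^+ 2.
  by rewrite /e /r exprMn exprVn [RHS]mulrA.
have gq : g + h * ((1 + g) / (1 - h)) <= 103 / 100 * (w + (N + 1) * u).
  have q1 : (1 + g) / (1 - h) <= 1018 / 1000.
    by have := quot_le g_ge0 g1; have := g1; lra.
  have := ler_wpM2l h0 q1; have := h_le; have := g_le; have := w_ge0.
  (* The term u/50 of [g_le] fits into the slack in front of (N + 1) u because N + 1 >= 2. *)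
  have nu0 : 0 <= (N - 1) * u by rewrite mulr_ge0 ?subr_ge0 ?(ltW u0).
  by have := u0; move: nu0; lra.
have := ler_wpM2r (sqr_ge0 r) gq; have := cond_le; rewrite -/x -/s -/r; lra.
Qed.

Let YX_le : normF (Y^T *m Y - X^T *m X) <= e.
Proof. by have [[_ _ YG] _] := XWY; exact: cholesky_gram_le. Qed.

Let e24 : 24 * e <= s ^+ 2.
Proof.
have := e_le; rewrite ler_pdivrMr ?exprn_gt0//.
have := exprn_gt0 2 s0; lra.
Qed.

Let X_le (v : 'cV[R]_n) : s * normF v <= normF (X *m v).
Proof. exact: sigma_min_le. Qed.

Let WY_le : normF (W *m Y - X) <= k * (normF W * normF Y).
Proof. by have [_ WY] := XWY; exact: lemx_normF_le. Qed.

Let Yu : Y \in unitmx.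
Proof. by have [/fl_cholesky_unitmx Yu _] := XWY. Qed.

(** Up to constants the left side is t = N u r sqrt(N), and t^2 is the product of N^2 u and r^2 N u,
    each at most 1/64: the first by [nn_le], the second by [cond_le]. *)
Let tau1 : k * normF Y / s * sqn <= 16 / 1000.
Proof.
pose t := N * u * r * sqn.
have t0 : 0 <= t := mulr_ge0 (mulr_ge0 (mulr_ge0 (ler0n _ _) (ltW u0)) r0) sqn0.
have nr : 64 * r ^+ 2 * (N * u) <= 1.
  apply: le_trans cond_le; rewrite -/x -/s -/r ler_wpM2l//.
    by rewrite mulr_ge0 ?sqr_ge0.
  by have := w_ge0; have := u0; lra.
have t_le : t <= 1 / 64.
  rewrite -[leRHS]mulr1; apply: ler_of_sqr; [lra|exact: ler01|].
  have -> : t ^+ 2 = N * u * (r ^+ 2 * (N * u)) * (sqn * sqn) by rewrite /t; ring.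
  rewrite sqn2.
  have nn0 : 0 <= N * N * u by rewrite !mulr_ge0// ltW.
  have a1 : r ^+ 2 * (N * u) <= 1 / 64 by lra.
  by have := ler_wpM2l nn0 a1; have := nnu; have := nn_le; lra.
have kY : k * normF Y <= 1001 / 1000 * (N * u) * (101 / 100 * x).
  by rewrite ler_pM ?normF_ge0 ?k0 ?k_le ?Y_le.
have -> : k * normF Y / s * sqn = k * normF Y * (sqn / s) by ring.
have sqs : 0 <= sqn / s by exact: divr_ge0 sqn0 (ltW s0).
apply: (le_trans (ler_wpM2r sqs kY)).
have -> : 1001 / 1000 * (N * u) * (101 / 100 * x) * (sqn / s) =
    1001 / 1000 * (101 / 100) * t by rewrite /t /r; ring.
lra.
Qed.

Let W_gram : normF (W^T *m W - 1%:M) <= 1 / 18.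
Proof.
have tau58 : 58 * (k * normF Y / s * sqn) <= 1 by have := tau1; lra.
have := choleskyqr_orthogonality s0 k0 X_le YX_le e24 Yu WY_le tau58 n_gt0.
by rewrite -/sqn; have := e_le; have := tau1; lra.
Qed.

(** |W|_F^2 = n + tr(W^T W - I), and the trace is at most sqrt(n)/18 <= n/18. *)
Let W_sqr : normF W ^+ 2 <= 19 / 18 * N.
Proof.
have := le_trans (ler_norm _) (mxtrace_le (W^T *m W - 1%:M)).
rewrite linearB/= mxtrace_gram mxtrace1 -/sqn => W2.
have := ler_wpM2l sqn0 W_gram; have := sqn2; have := sqn1.
nra.
Qed.

(** A lower bound for sigma_min(W), just below sqrt(17/18). *)
Let s2 : R := 971 / 1000.
Let s20 : 0 < s2. Proof. by rewrite /s2; lra. Qed.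

Let W_ge (v : 'cV[R]_n) : s2 * normF v <= normF (W *m v).
Proof.
have := near_orthonormal v W_gram.
have := ler_norm (- (normF (W *m v) ^+ 2 - normF v ^+ 2)); rewrite normrN.
move=> a1 a2; have := le_trans a1 a2 => a3.
rewrite -[leRHS]mul1r; apply: ler_of_sqr; [exact: ler01|exact: normF_ge0|].
rewrite exprMn /s2; have := sqr_ge0 (normF v); lra.
Qed.

Variables (Q : 'M[R]_(m, n)) (Z S : 'M[R]_n).
Hypothesis WQZ : fl_choleskyqr W Q Z.
Hypothesis ZYS : fl_mulmx Z Y S.

Let B : R := M * N * u + N * (N + 1) * u.

Let B_le : B <= 1 / 32.
Proof. by rewrite /B; have := mn_le; have := nn_le; lra. Qed.

Let gm1 : gm <= 1 / 60.
Proof. by have := gm_le; have := mu; rewrite -uE; lra. Qed.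

Let Z_sqr : normF Z ^+ 2 <= 1073 / 1000 * N.
Proof.
have [G2 [/lemx_absB G2W [[_ _ ZG] _]]] := WQZ.
apply: (le_trans (cholesky_sqr_normF_le h1 G2W ZG)).
have q1 := quot_le gm0 gm1.
have q2 : (1 + gm) / (1 - h) <= 10163 / 10000.
  by have := gm_le; have := mu; rewrite -uE; lra.
apply: (le_trans (ler_wpM2r (sqr_ge0 _) q2)).
by have := W_sqr; have := n1; lra.
Qed.

Let Z_le : normF Z <= 1036 / 1000 * sqn.
Proof.
apply: ler_of_sqr; [lra|exact: sqn0|].
by rewrite [sqn ^+ 2]expr2 sqn2; have := Z_sqr; have := n1; lra.
Qed.

Let e2 : R := (gm + h * ((1 + gm) / (1 - h))) * normF W ^+ 2.

(** |W|_F^2 <= (19/18) n supplies the factor n that turns m u + (n + 1) u into [B]. *)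
Let e2_le : e2 <= 1075 / 1000 * B.
Proof.
have q2 : (1 + gm) / (1 - h) <= 10163 / 10000.
  by have := quot_le gm0 gm1; have := gm_le; have := mu; rewrite -uE; lra.
have a1 : gm + h * ((1 + gm) / (1 - h)) <= 1018 / 1000 * (M * u + (N + 1) * u).
  have := ler_wpM2l h0 q2; have := h_le; have := gm_le.
  have : 0 <= M * u by rewrite mulr_ge0 ?ler0n// ltW.
  have : 0 <= (N + 1) * u by rewrite mulr_ge0 ?addr_ge0// ltW.
  lra.
have a0 : 0 <= M * u + (N + 1) * u.
  by rewrite -mulrDl mulr_ge0 ?addr_ge0// ltW.
rewrite /e2; apply: (le_trans (ler_wpM2r (sqr_ge0 _) a1)).
have := ler_wpM2l a0 W_sqr.
have -> : B = (M * u + (N + 1) * u) * N by rewrite /B; ring.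
have : 0 <= (M * u + (N + 1) * u) * N by rewrite mulr_ge0.
lra.
Qed.

Let ZW_le : normF (Z^T *m Z - W^T *m W) <= e2.
Proof.
have [G2 [/lemx_absB G2W [[_ _ ZG] _]]] := WQZ.
exact: cholesky_gram_le.
Qed.

Let QZ_le : normF (Q *m Z - W) <= k * (normF Q * normF Z).
Proof. by have [G2 [_ [_ QZ]]] := WQZ; exact: lemx_normF_le. Qed.

Let Zu : Z \in unitmx.
Proof. by have [G2 [_ [/fl_cholesky_unitmx Zu _]]] := WQZ. Qed.

(** The second run starts from [W], whose singular values are at least [s2], so the conditioning of
    [X] no longer appears: the Gram error is of order [B] and the solve error of order n^2 u. *)
Lemma choleskyqr2_orthogonality : normF (Q^T *m Q - 1%:M) <= 6 * B.
Proof.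
have e224 : 24 * e2 <= s2 ^+ 2.
  by rewrite /s2; have := e2_le; have := B_le; lra.
have tau_le : k * normF Z / s2 * sqn <= 107 / 100 * (N * N * u).
  have sqs : 0 <= sqn / s2 by exact: divr_ge0 sqn0 (ltW s20).
  have -> : k * normF Z / s2 * sqn = k * normF Z * (sqn / s2) by ring.
  have kZ : k * normF Z <= 1001 / 1000 * (N * u) * (1036 / 1000 * sqn).
    by rewrite ler_pM ?normF_ge0 ?k0 ?k_le ?Z_le.
  apply: (le_trans (ler_wpM2r sqs kZ)).
  have -> : 1001 / 1000 * (N * u) * (1036 / 1000 * sqn) * (sqn / s2) =
      1001 / 1000 * (1036 / 1000) / s2 * (N * u * (sqn * sqn)) by ring.
  rewrite sqn2.
  have : 0 <= N * N * u by rewrite !mulr_ge0// ltW.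
  by rewrite /s2; lra.
have tau58 : 58 * (k * normF Z / s2 * sqn) <= 1.
  by have := nnu; have := nn_le; lra.
have := choleskyqr_orthogonality s20 k0 W_ge ZW_le e224 Zu QZ_le tau58 n_gt0.
rewrite -/sqn; have a1 : e2 / s2 ^+ 2 <= 114 / 100 * B + 1 / 100 * B.
  rewrite ler_pdivrMr ?exprn_gt0// /s2; have := e2_le.
  have : 0 <= B by rewrite /B addr_ge0// !mulr_ge0 ?addr_ge0// ltW.
  lra.
have : 0 <= M * N * u by rewrite !mulr_ge0// ltW.
have : 0 <= N * N * u by rewrite !mulr_ge0// ltW.
have := nnu; rewrite /B in a1 *; lra.
Qed.

Let Q_op_le : op_le Q (109 / 100).
Proof.
(* 6 B <= 3/16, and (109/100)^2 exceeds 19/16. *)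
move=> v; apply: ler_of_sqr; [lra|exact: normF_ge0|].
have := near_orthonormal v choleskyqr2_orthogonality.
have := ler_norm (normF (Q *m v) ^+ 2 - normF v ^+ 2).
have := ler_wpM2r (sqr_ge0 (normF v)) B_le; have := sqr_ge0 (normF v); lra.
Qed.

Let c109 : 0 <= 109 / 100 :> R. Proof. lra. Qed.

Let Q_le : normF Q <= 109 / 100 * sqn.
Proof. exact: op_le_normF_le Q_op_le. Qed.

Let W_le : normF W <= 1028 / 1000 * sqn.
Proof.
apply: ler_of_sqr; [lra|exact: sqn0|].
by rewrite [sqn ^+ 2]expr2 sqn2; have := W_sqr; have := n1; lra.
Qed.

(** The outer factors [Q] and [Y] of the first two brackets are measured in operator norm. The first
    and third brackets then give the term in |X|_F, and the second, through the operator bound on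
    [Y], the term in sqrt(n) c. *)
Lemma choleskyqr2_residual (c : R) : 0 <= c -> op_le X c ->
  normF (Q *m S - X) <=
    (230 / 100 * x + 121 / 100 * sqn * c) * (N * sqn * u).
Proof.
move=> c0 Xc; have Yc : op_le Y (1021 / 1000 * c).
  exact: (cholesky_op_le s0 X_le YX_le e24 c0 Xc).
have c10 : 0 <= 1021 / 1000 * c by apply: mulr_ge0; [lra|].
have -> : Q *m S - X =
    (Q *m (S - Z *m Y) + (Q *m Z - W) *m Y) + (W *m Y - X).
  by rewrite mulmxBr mulmxBl mulmxA !addrA !subrK.
apply: (le_trans (normFD _ _)).
apply: (@le_trans _ _ (normF (Q *m (S - Z *m Y)) + normF ((Q *m Z - W) *m Y) +
  normF (W *m Y - X))); first by rewrite lerD2r normFD.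
have nu0 : 0 <= N * u by rewrite mulr_ge0// ltW.
have ku0 : 0 <= 1001 / 1000 * (N * u) by apply: mulr_ge0; [lra|].
have t1 : normF (Q *m (S - Z *m Y)) <=
    109 / 100 * (1001 / 1000 * (N * u) * ((1036 / 1000 * sqn) * (101 / 100 * x))).
  apply: (le_trans (op_le_mull _ c109 Q_op_le)); apply: ler_wpM2l => [|]; first exact: c109.
  apply: (le_trans (lemx_normF_le k0 (lemx_absB ZYS))).
  exact: (ler_pM k0 (mulr_ge0 (normF_ge0 Z) (normF_ge0 Y)) k_le
    (ler_pM (normF_ge0 Z) (normF_ge0 Y) Z_le Y_le)).
have t2 : normF ((Q *m Z - W) *m Y) <= 1021 / 1000 * c *
    (1001 / 1000 * (N * u) * ((109 / 100 * sqn) * (1036 / 1000 * sqn))).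
  apply: (le_trans (op_le_mulr _ c10 Yc)); apply: ler_wpM2l => [|]; first exact: c10.
  apply: (le_trans QZ_le).
  exact: (ler_pM k0 (mulr_ge0 (normF_ge0 Q) (normF_ge0 Z)) k_le
    (ler_pM (normF_ge0 Q) (normF_ge0 Z) Q_le Z_le)).
have t3 : normF (W *m Y - X) <=
    1001 / 1000 * (N * u) * ((1028 / 1000 * sqn) * (101 / 100 * x)).
  apply: (le_trans WY_le).
  exact: (ler_pM k0 (mulr_ge0 (normF_ge0 W) (normF_ge0 Y)) k_le
    (ler_pM (normF_ge0 W) (normF_ge0 Y) W_le Y_le)).
have y0 : 0 <= N * u * sqn * x by rewrite !mulr_ge0// ltW.
have z0 : 0 <= N * u * sqn * sqn * c by rewrite !mulr_ge0// ltW.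
lra.
Qed.

End CholeskyQR2.

(** * Exponential inequalities on the real line *)

Section RealInequalities.
Import numFieldNormedType.Exports.
Variable R : realType.

Lemma ger0_is_derive_le (f df : R -> R) (a b : R) : a <= b ->
  (forall x : R, is_derive x 1 f (df x)) ->
  (forall x, a <= x <= b -> 0 <= df x) -> f a <= f b.
Proof.
move=> ab fdf df0; have fc : {within `[a, b], continuous f}.
  by apply: derivable_within_continuous => x _; have [] := fdf x.
have [c cab fab] := MVT_segment ab (fun x _ => fdf x) fc.
by rewrite -subr_ge0 fab mulr_ge0 ?subr_ge0// df0.
Qed.

(* [psi x := (e^x + e^-x) e^(-x^2/2)] is nonincreasing for [x >= 0], since its
   derivative has the sign of [-phi x] with [phi x := x (e^x + e^-x) - (e^x - e^-x)],
   and [phi] is nondecreasing with [phi 0 = 0]. *)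
Lemma cosh_le_expR_sqr (x : R) : expR x + expR (- x) <= 2 * expR (x ^+ 2 / 2).
Proof.
wlog x0 : x / 0 <= x.
  move=> h; have [/h//|/ltW x0] := leP 0 x.
  by have := h (- x); rewrite oppr_ge0 opprK sqrrN addrC; exact.
pose phi (y : R) := y * (expR y + expR (- y)) - (expR y - expR (- y)).
have phi_ge0 y : 0 <= y -> 0 <= phi y.
  move=> y0; have <- : phi 0 = 0 by rewrite /phi oppr0 mul0r subrr subr0.
  apply: (@ger0_is_derive_le _ (fun z => z * (expR z - expR (- z)))) => // [z|z /andP[z0 _]].
    rewrite /phi; apply: is_derive_eq.
    rewrite /GRing.scale/=; ring.
  by rewrite mulr_ge0// subr_ge0 ler_expR; lra.
pose psi (y : R) := - ((expR y + expR (- y)) * expR (- (y ^+ 2 / 2))).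
have : psi 0 <= psi x.
  apply: (@ger0_is_derive_le _ (fun z => phi z * expR (- (z ^+ 2 / 2)))) => // [z|z /andP[z0 _]].
    have d2 : is_derive z 1 (fun y : R => expR (- (y ^+ 2 / 2)))
        (expR (- (z ^+ 2 / 2)) * - z).
      have dq : is_derive z 1 (fun y : R => - (y ^+ 2 / 2)) (- z).
        by apply: is_derive_eq; rewrite /GRing.scale/=; field.
      exact: (@is_derive1_comp R expR (fun y => - (y ^+ 2 / 2)) z _ _ _ dq).
    have d1 : is_derive z 1 (fun y : R => expR y + expR (- y))
        (expR z - expR (- z)) by apply: is_derive_eq; rewrite mulrN1.
    apply: (is_derive_eq (is_deriveN (is_deriveM d1 d2))).
    by rewrite /phi /GRing.scale/=; ring.
  by rewrite mulr_ge0 ?expR_ge0 ?phi_ge0.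
rewrite /psi oppr0 expr0n mul0r oppr0 expR0 lerN2 mulr1 => psi_le.
by rewrite -ler_pdivrMr ?expR_gt0// -expRN.
Qed.

(* Convexity of [exp] on [[-a, a]], through its tangent at [l * x]. *)
Lemma expR_le_chord (l u x : R) : 0 < u -> `|x| <= u ->
  expR (l * x) <= (expR (l * u) + expR (- (l * u))) / 2
    + (expR (l * u) - expR (- (l * u))) / (2 * u) * x.
Proof.
move=> u0 xu; set p := l * x; set a := l * u.
have tangent b : expR p * (1 + (b - p)) <= expR b.
  have := ler_wpM2l (expR_ge0 p) (expR_ge1Dx (b - p)).
  by rewrite -expRD [p + _]addrC subrK.
have [xl xr] : - u <= x /\ x <= u by apply/andP; rewrite -ler_norml.
pose t := (1 + x / u) / 2.
have r1 : - 1 <= x / u by rewrite ler_pdivlMr// mulN1r.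
have r2 : x / u <= 1 by rewrite ler_pdivrMr// mul1r.
have t0 : 0 <= t by rewrite /t; lra.
have t1 : 0 <= 1 - t by rewrite /t; lra.
have h1 := ler_wpM2l t0 (tangent a); have h2 := ler_wpM2l t1 (tangent (- a)).
have pE : p = t * a + (1 - t) * - a.
  by rewrite /p /t /a; field; rewrite gt_eqF.
have -> : (expR a + expR (- a)) / 2 + (expR a - expR (- a)) / (2 * u) * x =
    t * expR a + (1 - t) * expR (- a).
  by rewrite /t; field; rewrite gt_eqF.
apply: le_trans (lerD h1 h2).
rewrite le_eqVlt; apply/orP; left; apply/eqP.
transitivity (expR p * (1 + ((t * a + (1 - t) * - a) - p))); last ring.
by rewrite -pE subrr addr0 mulr1.
Qed.

(* [1 + d >= exp (d / (1 + d)) >= exp (d - u^2 / (1 - u))] *)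
Lemma prod_1D_le (I : Type) (s : seq I) (d : I -> R) (u c : R) :
  0 <= u -> u < 1 -> (forall i, `|d i| <= u) -> `|\sum_(i <- s) d i| <= c ->
  `|\prod_(i <- s) (1 + d i) - 1| <=
    expR (c + (size s)%:R * (u ^+ 2 / (1 - u))) - 1.
Proof.
move=> u0 u1 du sc; set v := u ^+ 2 / (1 - u); set T := c + _.
have v0 : 0 <= v by rewrite divr_ge0 ?sqr_ge0// subr_ge0 ltW.
have d_ge i : - u <= d i by have := du i; rewrite ler_norml => /andP[].
have d1 i : 0 < 1 + d i by have := d_ge i; lra.
have lo i : expR (d i - v) <= 1 + d i.
  have h := expR_ge1Dx (- (d i / (1 + d i))).
  have e1 : 1 + - (d i / (1 + d i)) = (1 + d i)^-1.
    by field; rewrite gt_eqF.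
  rewrite e1 expRN lef_pV2 ?posrE ?expR_gt0// in h.
  apply: le_trans h; rewrite ler_expR.
  have -> : d i / (1 + d i) = d i - d i ^+ 2 / (1 + d i).
    by field; rewrite gt_eqF.
  rewrite lerD2l lerN2 ler_pM ?sqr_ge0 ?invr_ge0 ?(ltW (d1 _))//.
    by rewrite -(real_normK (num_real (d i))) lerXn2r ?nnegrE.
  by rewrite lef_pV2 ?posrE ?subr_gt0//; have := d_ge i; lra.
have up i : 1 + d i <= expR (d i) := expR_ge1Dx _.
have loP : expR (\sum_(i <- s) d i - (size s)%:R * v) <= \prod_(i <- s) (1 + d i).
  have -> : \sum_(i <- s) d i - (size s)%:R * v = \sum_(i <- s) (d i - v).
    by rewrite sumrB big_const_seq count_predT iter_addr_0 mulr_natl.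
  by rewrite expR_sum; apply: ler_prod => i _; rewrite expR_ge0/= lo.
have upP : \prod_(i <- s) (1 + d i) <= expR (\sum_(i <- s) d i).
  by rewrite expR_sum; apply: ler_prod => i _; rewrite (ltW (d1 _))/= up.
have [c1 c2] : - c <= \sum_(i <- s) d i /\ \sum_(i <- s) d i <= c.
  by apply/andP; rewrite -ler_norml.
have sv : 0 <= (size s)%:R * v by rewrite mulr_ge0.
have TE : \sum_(i <- s) d i <= T by rewrite /T; lra.
have TN : - T <= \sum_(i <- s) d i - (size s)%:R * v by rewrite /T; lra.
rewrite -ler_expR in TE; rewrite -ler_expR in TN.
have TT : 2 <= expR T + expR (- T).
  by have := expR_ge1Dx T; have := expR_ge1Dx (- T); lra.
rewrite ler_norml; apply/andP; split; lra.
Qed.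

End RealInequalities.

(** * Concentration of rounding errors *)

(* A summand of the computed inner product: its index, and the positions of the
   errors on the path from the root to the corresponding leaf. *)
Fixpoint dot_terms m (e : dot_tree m) : seq ('I_m * seq nat) :=
  match e with
  | DotMul t i => [:: (i, [:: t])]
  | DotAdd t l r => [seq (p.1, t :: p.2) | p <- dot_terms l ++ dot_terms r]
  end.

Section DotTerms.
Variable m : nat.
Implicit Type e : dot_tree m.

Lemma dot_terms_indices e : [seq p.1 | p <- dot_terms e] = dot_indices e.
Proof.
elim: e => //= t l IHl r IHr.
by rewrite -map_comp -IHl -IHr -map_cat; apply: eq_map.
Qed.

Lemma dot_terms_positions e p : p \in dot_terms e ->
  {subset p.2 <= dot_positions e}.
Proof.
elim: e p => [t i|t l IHl r IHr] p /=; first by rewrite inE => /eqP ->.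
move=> /mapP[q]; rewrite mem_cat => qe -> s /=; rewrite !inE.
move=> /orP[->//|sq]; rewrite mem_cat.
by case/orP: qe => [/IHl/(_ _ sq)->|/IHr/(_ _ sq)->]; rewrite ?orbT.
Qed.

(** The root comes first in the list but is executed last, so positions decrease. This is the order
    in which [expsum_moment] removes errors, latest first. *)
Lemma dot_terms_sorted e p : dot_chronological e -> p \in dot_terms e ->
  sorted gtn p.2.
Proof.
elim: e p => [t i|t l IHl r IHr] p /=; first by rewrite inE => _ /eqP ->.
move=> /and3P[/allP lt_t cl cr] /mapP[q qe ->] /=.
rewrite path_min_sorted; last first.
  apply/allP => s sq; apply: lt_t; rewrite mem_cat.
  by move: qe; rewrite mem_cat => /orP[]/dot_terms_positions/(_ _ sq)->;
    rewrite ?orbT.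
by move: qe; rewrite mem_cat => /orP[/(IHl _ cl)|/(IHr _ cr)].
Qed.

Lemma dot_indices_gt0 e : (0 < size (dot_indices e))%N.
Proof. by elim: e => //= _ l IHl r _; rewrite size_cat addn_gt0 IHl. Qed.

(** Each addition on a path joins a further nonempty subtree, so a path is no longer than the number
    of leaves. *)
Lemma dot_terms_size e p : p \in dot_terms e ->
  (size p.2 <= size (dot_indices e))%N.
Proof.
elim: e p => [t i|t l IHl r IHr] p /=; first by rewrite inE => /eqP ->.
move=> /mapP[q + ->] /=; rewrite mem_cat size_cat.
have l0 := dot_indices_gt0 l; have r0 := dot_indices_gt0 r.
by case/orP => [/IHl ql|/IHr qr];
  [rewrite -addn1 leq_add|rewrite -add1n leq_add].
Qed.

Lemma fl_dot_terms (R : realType) (delta : nat -> R) (x y : 'I_m -> R) e :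
  fl_dot delta x y e =
    \sum_(p <- dot_terms e) x p.1 * y p.1 * \prod_(t <- p.2) (1 + delta t).
Proof.
elim: e => [t i|t l IHl r IHr] /=; first by rewrite !big_seq1.
rewrite IHl IHr -big_cat/= big_map mulr_suml; apply: eq_bigr => p _.
by rewrite big_cons mulrA mulrAC.
Qed.

Lemma fl_dot_error (R : realType) (delta : nat -> R) (x y : 'I_m -> R) e g :
  dot_order e ->
  (forall p, p \in dot_terms e -> `|\prod_(t <- p.2) (1 + delta t) - 1| <= g) ->
  `|fl_dot delta x y e - \sum_i x i * y i| <= g * \sum_i `|x i| * `|y i|.
Proof.
move=> [ep _ _] eg.
have sumE (F : 'I_m -> R) : \sum_i F i = \sum_(p <- dot_terms e) F p.1.
  rewrite -[RHS](big_map (fun p => p.1) predT F) dot_terms_indices.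
  by rewrite (perm_big _ ep) big_enum.
rewrite fl_dot_terms !sumE -sumrB mulr_sumr.
apply: (le_trans (ler_norm_sum _ _ _)).
rewrite !big_seq; apply: ler_sum => p pe.
rewrite -[X in _ - X]mulr1 -mulrBr !normrM mulrC.
by rewrite ler_wpM2r ?mulr_ge0// eg.
Qed.

End DotTerms.

(** * Azuma-Hoeffding bound for sums of rounding errors *)

Section RoundingMartingale.
Context {d : measure_display} {Om : measurableType d} {R : realType}.
Variables (P : probability Om R) (delta : nat -> {RV P >-> R}).
Hypothesis delta_model : random_rounding_errors delta.

Local Notation u := (uroundoff : R).

Let delta_le k w : `|delta k w| <= u.
Proof. by have [] := delta_model k. Qed.

Let u_gt0 : 0 < u := uroundoff_gt0 R.

Lemma bounded_integrable (f : Om -> R) (K : R) :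
  measurable_fun setT f -> (forall w, `|f w| <= K) ->
  P.-integrable setT (EFin \o f).
Proof.
move=> mf fK; apply: measurable_bounded_integrable => //.
  by rewrite -ge0_fin_numE// fin_num_measure.
exists K; split; first exact: num_real.
by move=> M KM w _ /=; exact: le_trans (fK w) (ltW KM).
Qed.

Let past k := g_sigma_preimage (fun i : 'I_k => delta i : Om -> R).

Lemma Rintegral_sum I (s : seq I) (f : I -> Om -> R) :
  (forall i, P.-integrable setT (EFin \o f i)) ->
  P.-integrable setT (EFin \o (fun w => \sum_(i <- s) f i w)) /\
  \int[P]_w (\sum_(i <- s) f i w) = \sum_(i <- s) \int[P]_w f i w.
Proof.
move=> fi; elim: s => [|i s [IH1 IH2]].
  rewrite big_nil; under [X in EFin \o X]eq_fun do rewrite big_nil.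
  split; first exact: finite_measure_integrable_cst.
  by under eq_Rintegral do rewrite big_nil; rewrite Rintegral_cst// mul0r.
under [X in EFin \o X]eq_fun do rewrite big_cons; rewrite big_cons.
split; first exact: (integrableD measurableT (fi i) IH1).
by under eq_Rintegral do rewrite big_cons; rewrite RintegralD// IH2.
Qed.

Lemma integral_past_indic k A : measurable A -> past k A ->
  \int[P]_w (\1_A w * delta k w) = 0.
Proof.
move=> mA pA; have [_ [_ _ /(_ _ pA) dA] _] := delta_model k.
have A0 : (\int[P]_(w in A) (delta k w)%:E = 0)%E by rewrite -dA integral0_eq.
rewrite /Rintegral.
rewrite (_ : (fun w => (\1_A w * delta k w)%:E) = (fun w => (delta k w)%:E) \_ A).
  by rewrite -integral_mkcond A0.
apply/funext => w; rewrite patchE indicE.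
by case: (w \in A); rewrite ?mul1r ?mul0r.
Qed.

(** The sum is the integer part of [y], written with threshold indicators so that a bounded function
    of the past is approximated by indicators of past events. *)
Lemma count_approx L (y : R) : 0 <= y -> y <= L%:R ->
  `|y - \sum_(i < L) (i.+1%:R <= y)%R%:R| <= 1.
Proof.
elim: L => [|L IH] y0 yL.
  by rewrite big_ord0 subr0 (le_anti (introT andP (conj yL y0))) normr0.
rewrite big_ord_recr/=; have [Ly|yL1] := leP L.+1%:R y.
  have -> : y = L.+1%:R by apply/le_anti; rewrite yL Ly.
  rewrite (eq_bigr (fun=> 1)) => [|i _].
    by rewrite sumr_const card_ord natr1 subrr normr0.
  by rewrite ler_nat ltnW// ltnS.
rewrite addr0; have [yL'|Ly] := leP y L%:R; first exact: IH.
rewrite (eq_bigr (fun=> 1)) => [|i _]; last first.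
  by rewrite (le_trans _ (ltW Ly))// ler_nat.
rewrite sumr_const card_ord -natr1 in yL1 *.
rewrite ger0_norm ?subr_ge0 ?ltW//; lra.
Qed.

Lemma measurable_ge (f : Om -> R) c :
  measurable_fun setT f -> measurable [set w | c <= f w].
Proof.
move=> mf; rewrite (_ : [set _ | _] = setT `&` f @^-1` `[c, +oo[%classic).
  exact: mf.
by rewrite setTI; apply/seteqP; split => w /=; rewrite in_itv/= andbT.
Qed.

(* [y] is within [1] of the sum of the past indicators of [i <= y], i = 1, 2, ...,
   each of which is orthogonal to [delta k]. *)
Lemma integral_mul_past_le k (y : Om -> R) (K : R) :
  measurable_fun setT y -> (forall w, 0 <= y w <= K) ->
  (forall c, past k [set w | c <= y w]) ->
  `|\int[P]_w (y w * delta k w)| <= u.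
Proof.
move=> my yK py; pose L := Num.bound K.
pose S w := \sum_(i < L) \1_[set w | i.+1%:R <= y w] w : R.
have mind (i : nat) : measurable [set w | i.+1%:R <= y w] by exact: measurable_ge.
have mS : measurable_fun setT S.
  by apply: measurable_sum => i; exact: measurable_indic.
have yL w : `|y w - S w| <= 1.
  have /andP[y0 yK'] := yK w.
  rewrite /S (eq_bigr (fun i : 'I_L => (i.+1%:R <= y w)%R%:R)); last first.
    by move=> i _; rewrite indicE; congr ((nat_of_bool _)%:R); apply/idP/idP;
      rewrite inE.
  apply: count_approx => //; apply: (le_trans yK').
  by rewrite ltW// archi_boundP// (le_trans y0).
have Sd : \int[P]_w (S w * delta k w) = 0.
  under eq_Rintegral do rewrite /S mulr_suml.
  rewrite (proj2 (Rintegral_sum _ _)) => [|i].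
    by rewrite big1// => i _; exact: integral_past_indic.
  apply: (@bounded_integrable _ u) => [|w].
    by apply: measurable_funM => //; exact: measurable_indic.
  rewrite normrM -[leRHS]mul1r ler_pM//.
  by rewrite indicE; case: (_ \in _); rewrite ?normr1 ?normr0.
have yi : P.-integrable setT (EFin \o (fun w => y w * delta k w)).
  apply: (@bounded_integrable _ (K * u)) => [|w]; first exact: measurable_funM.
  by have /andP[y0 yK'] := yK w; rewrite normrM ler_pM// ger0_norm.
have Si : P.-integrable setT (EFin \o (fun w => S w * delta k w)).
  apply: (@bounded_integrable _ ((K + 1) * u)) => [|w]; first exact: measurable_funM.
  rewrite normrM ler_pM//; have /andP[y0 yK'] := yK w.
  by have := yL w; rewrite !ler_norml; lra.
rewrite -[X in `|X|]subr0 -Sd -RintegralB//.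
have yS w : `|y w * delta k w - S w * delta k w| <= u.
  by rewrite -mulrBl normrM -[leRHS]mul1r ler_pM.
have ySi : P.-integrable setT (EFin \o (fun w => y w * delta k w - S w * delta k w)).
  apply: (@bounded_integrable _ u) => //.
  by apply: measurable_funB; exact: measurable_funM.
apply: (le_trans (le_normr_Rintegral measurableT ySi)).
apply: (@le_trans _ _ (\int[P]_w (cst u w))); last first.
  by rewrite Rintegral_cst// [X in fine X](@probability_setT _ _ _ P) mulr1.
apply: le_Rintegral => //; first exact: (integrable_norm ySi).
exact: finite_measure_integrable_cst.
Qed.

(* The previous bound applies to every multiple of [y], so the integral is [0]. *)
Lemma integral_mul_past0 k (y : Om -> R) (K : R) :
  measurable_fun setT y -> (forall w, 0 <= y w <= K) ->
  (forall c, past k [set w | c <= y w]) ->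
  \int[P]_w (y w * delta k w) = 0.
Proof.
move=> my yK py.
have yi : P.-integrable setT (EFin \o (fun w => y w * delta k w)).
  apply: (@bounded_integrable _ (K * u)) => [|w]; first exact: measurable_funM.
  by have /andP[y0 yK'] := yK w; rewrite normrM ler_pM// ger0_norm.
set I := LHS; have NI N : N.+1%:R * `|I| <= u.
  rewrite -[N.+1%:R]ger0_norm// -normrM -RintegralZl//.
  under eq_Rintegral do rewrite mulrA.
  apply: (@integral_mul_past_le k _ (N.+1%:R * K)) => [|w|c].
  - exact: measurable_funM.
  - by have /andP[y0 yK'] := yK w; rewrite mulr_ge0//= ler_wpM2l.
  - rewrite (_ : [set _ | _] = [set w | c / N.+1%:R <= y w]) //.
    by apply/seteqP; split => w /=; rewrite ler_pdivrMr// mulrC.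
apply/eqP; rewrite -normr_eq0 eq_le normr_ge0 andbT leNgt; apply/negP => I0.
have := NI (Num.bound (u / `|I|)); apply/negP; rewrite -ltNge -ltr_pdivrMr//.
apply: (lt_trans (archi_boundP _)); first by rewrite divr_ge0 ?ltW.
by rewrite ltr_nat.
Qed.

Let psum s w : R := \sum_(t <- s) delta t w.

Let measurable_psum s : measurable_fun setT (psum s).
Proof. by apply: measurable_sum. Qed.

Let psum_le s w : `|psum s w| <= (size s)%:R * u.
Proof.
apply: (le_trans (ler_norm_sum _ _ _)).
rewrite -sum1_size natr_sum mulr_suml; apply: ler_sum => t _.
by rewrite mul1r.
Qed.

Let expsum (l : R) s w : R := expR (l * psum s w).

Let expsum_le l s w : expsum l s w <= expR (`|l| * ((size s)%:R * u)).
Proof.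
rewrite ler_expR (le_trans (ler_norm _))// normrM ler_wpM2l//.
Qed.

Let measurable_expsum l s : measurable_fun setT (expsum l s).
Proof. by apply: measurableT_comp => //; exact: measurable_funM. Qed.

Let expsum_integrable l s : P.-integrable setT (EFin \o expsum l s).
Proof.
apply: (@bounded_integrable _ (expR (`|l| * ((size s)%:R * u)))) => // w.
by rewrite ger0_norm ?expR_ge0.
Qed.

(** [g_sigma_algebraType C] equips [Om] with the sigma-algebra of the past alone, so closure of
    measurable functions under sums and composition applies there. *)
Lemma past_expsum_ge k l s c : all (fun t => (t < k)%N) s ->
  past k [set w | c <= expsum l s w].
Proof.
pose C := \big[setU/set0]_(i < k)
  preimage_set_system setT (delta i : Om -> R) measurable.
have md (t : nat) : (t < k)%N ->
    measurable_fun setT (delta t : g_sigma_algebraType C -> R).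
  move=> tk _ B mB; apply: sub_sigma_algebra.
  rewrite /C (bigD1 (Ordinal tk))//=; left.
  by exists B.
move=> sk.
have mp : measurable_fun setT (psum s : g_sigma_algebraType C -> R).
  elim: s sk => [_|t s IH /= /andP[tk sk]].
    by rewrite /psum; under eq_fun do rewrite big_nil; exact: measurable_cst.
  rewrite /psum; under eq_fun do rewrite big_cons.
  by apply: measurable_funD; [exact: md|exact: IH].
have mE : measurable_fun setT (expsum l s : g_sigma_algebraType C -> R).
  by apply: measurableT_comp => //; exact: measurable_funM.
have := mE measurableT `[c, +oo[%classic (measurable_itv _).
rewrite setTI (_ : _ @^-1` _ = [set w | c <= expsum l s w])//.
by apply/seteqP; split => w /=; rewrite in_itv/= andbT.
Qed.

(** Induction on the list, whose head is the latest error. The chord bound replaces its exponential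
    by C + D delta_k; the D part integrates to 0 against the past, and C = cosh(l u) <= exp((l u)^2
    / 2). *)
Lemma expsum_moment (l : R) s : sorted gtn s ->
  \int[P]_w expsum l s w <= expR ((l * u) ^+ 2 / 2 * (size s)%:R).
Proof.
elim: s => [_|k s IH ks].
  under eq_Rintegral do rewrite /expsum /psum big_nil mulr0 expR0.
  rewrite Rintegral_cst// [X in fine X](@probability_setT _ _ _ P) mulr1.
  by rewrite mulr0 expR0.
have sk : all (fun t => (t < k)%N) s.
  by move: ks; rewrite /= path_sortedE => [/andP[]//|a b c /=]; exact: (fun h1 h2 => ltn_trans h2 h1).
have ss : sorted gtn s by move: ks => /= /path_sorted.
set C := (expR (l * u) + expR (- (l * u))) / 2.
set D := (expR (l * u) - expR (- (l * u))) / (2 * u).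
have step w : expsum l (k :: s) w <=
    C * expsum l s w + D * (expsum l s w * delta k w).
  rewrite /expsum /psum big_cons mulrDr expRD -/(psum s w) -/(expsum l s w).
  have := ler_wpM2r (expR_ge0 (l * psum s w)) (expR_le_chord l u_gt0 (delta_le k w)).
  rewrite -/C -/D -/(expsum l s w); lra.
have esi := expsum_integrable l s.
have di : P.-integrable setT (EFin \o (fun w => expsum l s w * delta k w)).
  apply: (@bounded_integrable _ (expR (`|l| * ((size s)%:R * u)) * u)) => [|w].
    exact: measurable_funM.
  by rewrite normrM ler_pM// ger0_norm ?expR_ge0.
have d0 : \int[P]_w (expsum l s w * delta k w) = 0.
  apply: (@integral_mul_past0 _ _ (expR (`|l| * ((size s)%:R * u)))) => // [w|c].
    by rewrite expR_ge0/=.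
  exact: past_expsum_ge.
have Ci : P.-integrable setT (EFin \o (fun w => C * expsum l s w)).
  exact: (integrableZl measurableT C esi).
have Di : P.-integrable setT (EFin \o (fun w => D * (expsum l s w * delta k w))).
  exact: (integrableZl measurableT D di).
apply: (@le_trans _ _ (\int[P]_w (C * expsum l s w +
    D * (expsum l s w * delta k w)))).
  by apply: le_Rintegral => //; exact: (integrableD measurableT Ci Di).
rewrite RintegralD// !RintegralZl// d0 mulr0 addr0.
have C0 : 0 <= C by rewrite divr_ge0// addr_ge0 ?expR_ge0.
have CE : C <= expR ((l * u) ^+ 2 / 2).
  by rewrite ler_pdivrMr// [leRHS]mulrC cosh_le_expR_sqr.
rewrite /= -[(size s).+1%:R]natr1 mulrDr mulr1 addrC expRD ler_pM//; last exact: IH.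
by apply: Rintegral_ge0 => w _; exact: expR_ge0.
Qed.

(* Markov's inequality for the sum over [s <- L] of
   [exp (- l c) (exp (l S_s) + exp (- l S_s))], with [c := eta sqrt m u]
   and [l := eta / (sqrt m u)]. *)
Lemma rounding_sums_concentration m (L : seq (seq nat)) (eta : R) :
  (0 < m)%N -> 0 < eta ->
  (forall s, s \in L -> sorted gtn s /\ (size s <= m)%N) ->
  with_probability_at_least P (1 - (size L)%:R * (2 * expR (- (eta ^+ 2 / 2))))
    [set w | forall s, s \in L ->
       `|\sum_(t <- s) delta t w| <= eta * Num.sqrt m%:R * u].
Proof.
move=> m0 eta0 Ls; set c : R := eta * _ * u.
have sm0 : 0 < Num.sqrt m%:R :> R by rewrite sqrtr_gt0 ltr0n.
have sm2 : Num.sqrt m%:R * Num.sqrt m%:R = m%:R :> R.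
  by rewrite -expr2 sqr_sqrtr.
pose l : R := eta / (Num.sqrt m%:R * u).
have l0 : 0 < l by rewrite divr_gt0 ?mulr_gt0.
have lc : l * c = eta ^+ 2.
  by rewrite /l /c; field; rewrite !gt_eqF.
have lu : (l * u) ^+ 2 * m%:R = eta ^+ 2.
  by rewrite -sm2 /l; field; rewrite !gt_eqF.
pose h s w : R := expR (- eta ^+ 2) * (expsum l s w + expsum (- l) s w).
have h0 s w : 0 <= h s w by rewrite mulr_ge0 ?addr_ge0 ?expR_ge0.
have ei s : P.-integrable setT (EFin \o (fun w => expsum l s w + expsum (- l) s w)).
  exact: (integrableD measurableT (expsum_integrable l s) (expsum_integrable (- l) s)).
have hi s : P.-integrable setT (EFin \o h s).
  exact: (integrableZl measurableT _ (ei s)).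
have hE s : s \in L -> \int[P]_w h s w <= 2 * expR (- (eta ^+ 2 / 2)).
  move=> /Ls[ss sm]; rewrite RintegralZl// RintegralD//.
  have moment (b : R) : b ^+ 2 = l ^+ 2 ->
      \int[P]_w expsum b s w <= expR (eta ^+ 2 / 2).
    move=> bl; apply: (le_trans (expsum_moment b ss)).
    rewrite ler_expR exprMn bl -exprMn -lu mulrAC ler_wpM2r ?invr_ge0//.
    by rewrite ler_wpM2l ?sqr_ge0// ler_nat.
  have -> : expR (- (eta ^+ 2 / 2)) = expR (- eta ^+ 2) * expR (eta ^+ 2 / 2).
    by rewrite -expRD; congr expR; lra.
  rewrite mulrCA ler_wpM2l ?expR_ge0// mulr_natl mulr2n.
  by rewrite lerD ?moment// sqrrN.
pose g w := \sum_(s <- L) h s w.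
have [gi gE] := Rintegral_sum L hi.
have {}gE : \int[P]_w g w <= (size L)%:R * (2 * expR (- (eta ^+ 2 / 2))).
  rewrite [leLHS]gE -sum1_size natr_sum mulr_suml big_seq [leRHS]big_seq.
  by apply: ler_sum => s /hE; rewrite mul1r.
have mg : measurable_fun setT g.
  by apply: measurable_sum => s; exact/measurable_EFinP/(measurable_int _ (hi s)).
have mA : measurable (~` [set w | 1 <= g w]).
  by apply: measurableC; exact: measurable_ge.
exists (~` [set w | 1 <= g w]); split => //.
- move=> w /= /negP; rewrite -ltNge => gw s sL; rewrite leNgt; apply/negP => cs.
  (* A sum beyond c in absolute value makes one of the two exponentials at least exp(l c) =
     exp(eta^2), hence h >= 1 and g >= 1. *)
  suff : 1 <= h s w.
    apply/negP; rewrite -ltNge (le_lt_trans _ gw)// /g (big_rem s)//=.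
    by rewrite lerDl sumr_ge0.
  rewrite /h expRN ler_pdivlMl ?expR_gt0// mulr1 -lc.
  have [S0|S0] := leP 0 (psum s w).
    rewrite ger0_norm// in cs.
    rewrite (@le_trans _ _ (expsum l s w))// ?lerDl ?expR_ge0//.
    by rewrite ler_expR ler_wpM2l ?ltW.
  rewrite ltr0_norm// in cs.
  rewrite (@le_trans _ _ (expsum (- l) s w))// ?lerDr ?expR_ge0//.
  by rewrite ler_expR mulNr -mulrN ler_wpM2l ?ltW.
- rewrite -[leRHS]fineK ?fin_num_measure// lee_fin.
  set A := ~` _.
  have <- : \int[P]_w \1_A w = fine (P A) by rewrite /Rintegral integral_indic// setIT.
  have ci : P.-integrable setT (EFin \o cst (1 : R)).
    exact: finite_measure_integrable_cst.
  have one : \int[P]_w cst (1 : R) w = 1.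
    by rewrite Rintegral_cst// [X in fine X](@probability_setT _ _ _ P) mulr1.
  (* Markov's inequality in the form 1 - g <= 1_A, integrated. *)
  apply: (@le_trans _ _ (\int[P]_w cst (1 : R) w - \int[P]_w g w)).
    by rewrite one lerD2l lerN2.
  rewrite -RintegralB//.
  apply: le_Rintegral => //.
  + exact: (integrableB measurableT ci gi).
  + exact: integrable_indic.
  + move=> w _; rewrite indicE lerBlDr; case: (boolP (w \in A)) => [_|].
      by rewrite lerDl sumr_ge0.
    by rewrite notin_setE /A /= add0r => /contrapT.
Qed.

Lemma fl_gram_random_error m n (X : 'M[R]_(m, n)) (G : Om -> 'M[R]_n) (eta : R) :
  (0 < m)%N -> 0 < eta -> fl_gram_random delta X G ->
  with_probability_at_least P (Qprob eta (m * n ^ 2))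
    [set w | lemx (absmx (G w - X^T *m X))
      ((expR (eta * Num.sqrt m%:R * u + m%:R * (u ^+ 2 / (1 - u))) - 1) *:
        (absmx X^T *m absmx X))].
Proof.
move=> m0 eta0 [e [eo Ge]]; set g := expR _ - 1.
(* All paths of all n^2 trees, m per tree: the union bound runs over these m n^2 lists. *)
pose L := flatten [seq [seq p.2 | p <- dot_terms (e ab.1 ab.2)]
  | ab : 'I_n * 'I_n].
have size_e a b : size (dot_indices (e a b)) = m.
  by have [/perm_size -> _ _] := eo a b; rewrite size_enum_ord.
have mem_L a b p : p \in dot_terms (e a b) -> p.2 \in L.
  move=> pe; apply/flattenP; exists [seq p.2 | p <- dot_terms (e a b)].
    by apply/mapP; exists (a, b); rewrite ?mem_enum.
  by apply/mapP; exists p.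
have LP s : s \in L -> sorted gtn s /\ (size s <= m)%N.
  move=> /flattenP[_ /mapP[[a b] _ ->] /mapP[p pe ->]] /=.
  have [_ _ ch] := eo a b; split; first exact: (dot_terms_sorted ch pe).
  by rewrite (leq_trans (dot_terms_size pe))// size_e.
have sizeL : size L = (m * n ^ 2)%N.
  rewrite size_flatten /shape -map_comp (eq_map (g := fun=> m)).
    rewrite sumnE big_map big_enum/= sum_nat_const.
    by rewrite [#|_|](card_prod 'I_n 'I_n) card_ord mulnn mulnC.
  by move=> [a b] /=; rewrite size_map -(size_map fst) dot_terms_indices.
have [A [mA AP PA]] := rounding_sums_concentration m0 eta0 LP.
exists A; split => //.
- move=> w /AP /= wL a b; rewrite !mxE Ge.
  under eq_bigr do rewrite mxE; under [in leRHS]eq_bigr do rewrite !mxE.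
  under [X in fl_dot _ X _]eq_fun do rewrite mxE.
  apply: fl_dot_error => // p pe.
  have := wL _ (mem_L _ _ _ pe); have [_ sp] := LP _ (mem_L _ _ _ pe).
  have u1 : u < 1 by rewrite invf_lt1 ?exprn_gt0// exprn_egt1// ltr1n.
  move=> /(prod_1D_le (ltW u_gt0) u1 (fun t => delta_le t w)) /le_trans; apply.
  rewrite lerB// ler_expR lerD2l ler_wpM2r ?ler_nat//.
  by rewrite divr_ge0 ?sqr_ge0// subr_ge0 ltW.
(* The exponent eta^2 / 2 obtained is at least the one in [Pprob], which carries the factor (1 -
   u)^2 <= 1. *)
- apply: le_trans PA; rewrite lee_fin sizeL /Qprob /Pprob.
  rewrite lerD2l lerN2 ler_wpM2l// opprB addrC subrK ler_wpM2l// ler_expR lerN2.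
  rewrite ler_wpM2r ?invr_ge0// ler_piMr ?sqr_ge0//.
  have u1 : u <= 1 by rewrite invf_le1 ?exprn_gt0// exprn_ege1// ler1n.
  by rewrite expr_le1// ?subr_ge0// gerBl ltW.
Qed.

End RoundingMartingale.

(** From exp(t) (1 - t) <= 1 and t <= 1/63, exp(t) - 1 <= (63/62) t. The second-order part of t is m
    u times u / (1 - u), at most u/63 because m u <= 1/64. *)
Lemma randomized_gamma_le (R : realType) (m : nat) (w : R) :
  0 <= w -> 64 * w <= 1 -> m%:R * uroundoff <= 1 / 64 :> R ->
  let g := expR (w + m%:R * (uroundoff ^+ 2 / (1 - uroundoff))) - 1 in
  0 <= g /\ g <= 1017 / 1000 * w + 1 / 50 * uroundoff.
Proof.
move=> w0 w64 mu; set u := uroundoff in mu *; set t := w + _.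
have u0 : 0 < u := uroundoff_gt0 R.
have u20 : u <= 2 ^- 20 := uroundoff_le R.
have u1 : 0 < 1 - u by lra.
have q0 : 0 <= u / (1 - u) by rewrite divr_ge0 ?ltW.
have q1 : u / (1 - u) <= 1001 / 1000 * u.
  rewrite ler_pdivrMr//.
  have c1 : 1 <= 1001 / 1000 * (1 - u) by lra.
  by have := ler_wpM2l (ltW u0) c1; lra.
have tE : t = w + m%:R * u * (u / (1 - u)) by rewrite /t; ring.
have mu0 : 0 <= m%:R * u by rewrite mulr_ge0// ltW.
have h1 := ler_wpM2r q0 mu; have h2 := mulr_ge0 mu0 q0.
have t0 : 0 <= t by lra.
have tle : t <= w + 1 / 63 * u by lra.
have t63 : t <= 1 / 63 by lra.
have eN : expR t * (1 - t) <= 1.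
  have := ler_wpM2l (expR_ge0 t) (expR_ge1Dx (- t)).
  by rewrite -expRD subrr expR0.
have e1 : 1 <= expR t by rewrite -expR0 ler_expR.
split; first lra.
have g0 : 0 <= expR t - 1 by lra.
by have := ler_wpM2l g0 t63; lra.
Qed.

(** * From the random event to the final bounds *)

Theorem theorem1 (R : realType) (d : measure_display) (Om : measurableType d)
    (P : probability Om R) (m n : nat) (X : 'M[R]_(m, n)) (eta : R)
    (delta : nat -> {RV P >-> R}) (G : Om -> 'M[R]_n)
    (n_ge1 : (1 <= n)%N) (n_le_m : (n <= m)%N)
    (X_full_column_rank : \rank X = n)
    (eta_gt0 : 0 < eta)
    (delta_model : random_rounding_errors delta)
    (G_computed : fl_gram_random delta X G) :
  let u : R := uroundoff in
  let j : R := normF X / norm2 X in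
  Num.max (eta * Num.sqrt m%:R * n%:R * u) (m%:R * n%:R * u) <= 1 / 64 ->
  n%:R * (n%:R + 1) * u <= 1 / 64 ->
  8 * j * kappa2 X * Num.sqrt (eta * Num.sqrt m%:R * u + (n%:R + 1) * u) <= 1 ->
  with_probability_at_least P (Qprob eta (m * n ^ 2))
    [set w | forall (Q : 'M[R]_(m, n)) (S : 'M[R]_n),
      fl_choleskyqr2_from (G w) X Q S ->
      normF (Q^T *m Q - 1%:M)
        <= 6 * (m%:R * n%:R * u + n%:R * (n%:R + 1) * u) /\
      normF (Q *m S - X)
        <= (230 / 100 * j + 121 / 100 * Num.sqrt n%:R)
           * (n%:R * Num.sqrt n%:R * u * norm2 X)].
Proof.
move=> u j; rewrite ge_max => /andP[wn_le mn_le] nn_le cond_le.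
have m_gt0 : (0 < m)%N := leq_trans n_ge1 n_le_m.
have u0 : 0 < u := uroundoff_gt0 R.
have n1 : 1 <= n%:R :> R by rewrite ler1n.
have X2 : 0 < norm2 X.
  apply: norm2_gt0; apply: contraTneq n_ge1 => X0.
  by rewrite -X_full_column_rank X0 mxrank0.
have s0 := sigma_min_gt0 n_ge1 X_full_column_rank.
pose w : R := eta * Num.sqrt m%:R * u.
have w0 : 0 <= w by rewrite !mulr_ge0 ?sqrtr_ge0 ?(ltW eta_gt0) ?(ltW u0).
have w64 : 64 * w <= 1.
  have : w * 1 <= w * n%:R by rewrite ler_wpM2l.
  by move: wn_le; rewrite mulrAC -/w; lra.
have mu : m%:R * u <= 1 / 64.
  by apply: le_trans mn_le; rewrite mulrAC ler_peMr ?mulr_ge0 ?ler0n ?(ltW u0).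
have [g0 g_le] := randomized_gamma_le w0 w64 mu.
have cond2 : 64 * (normF X / sigma_min X) ^+ 2 * (w + (n%:R + 1) * u) <= 1.
  have a0 : 0 <= w + (n%:R + 1) * u.
    by rewrite addr_ge0// mulr_ge0 ?addr_ge0 ?(ltW u0).
  have r0 : 0 <= normF X / sigma_min X by rewrite divr_ge0 ?normF_ge0 ?(ltW s0).
  (* The spectral norm cancels, so delta_1 depends on [X] only through |X|_F / sigma_min(X). *)
  have jk : j * kappa2 X = normF X / sigma_min X.
    by rewrite /j /kappa2 mulrA divfK// gt_eqF.
  move: cond_le; rewrite -[8 * j * _]mulrA jk -/w => cond_le.
  set r := normF X / _ in r0 cond_le *; set a := w + _ in a0 cond_le *.
  have sa : Num.sqrt a ^+ 2 = a by rewrite sqr_sqrtr.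
  have b0 : 0 <= 8 * r * Num.sqrt a :=
    mulr_ge0 (mulr_ge0 (ler0n _ 8) r0) (sqrtr_ge0 _).
  have -> : 64 * r ^+ 2 * a = 8 * r * Num.sqrt a * (8 * r * Num.sqrt a).
    by rewrite -[in LHS]sa; ring.
  by rewrite -[leRHS]mulr1 ler_pM.
have [A [mA AG PA]] := fl_gram_random_error delta_model m_gt0 eta_gt0 G_computed.
(* On this event the remaining argument is deterministic and covers every output that the model
   admits. *)
exists A; split => // w' /AG GX Q S [W [Y [Z [XWY WQZ ZYS]]]]; split.
  exact: (choleskyqr2_orthogonality n_ge1 X_full_column_rank (erefl u) w0 w64
    g0 g_le mn_le nn_le cond2 GX XWY WQZ).
apply: (le_trans (choleskyqr2_residual n_ge1 X_full_column_rank (erefl u) w0 w64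
    g0 g_le mn_le nn_le cond2 GX XWY WQZ ZYS (ltW X2) (@norm2_op_le _ _ _ X))).
have jX : normF X = j * norm2 X by rewrite /j divfK// gt_eqF.
by rewrite le_eqVlt jX; apply/orP; left; apply/eqP; ring.
Qed.
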